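(* Let $G$ be a finite simple connected graph with a weight function $w:E(G)\to\mathbb{R}_{>0}$. Then $(G,w)$ is weighted stable (i.e. a weighted distance-hereditary graph) if and only if $(G,w)$ has width $1$.
   Context: For a finite simple connected graph $G=(V,E)$ with vertex variables $x_v$ ($v\in V$), let $S(G)$ be the set of spanning trees of $G$, and for a weight function $w:E\to\mathbb{R}$ define the weighted vertex spanning tree polynomial $P_{G,w}(x_1,\dots,x_n)=\sum_{T\in S(G)}\prod_{e\in T}w(e)\prod_{v\in V}x_v^{\deg_T(v)-1}$. A real polynomial is real stable if it does not vanish when all variables are taken in the open upper half-plane $\{z\in\mathbb{C}:\operatorname{Im} z>0\}$. The weighted graph $(G,w)$ is called weighted stable if $P_{G,w}$ is real stable, and weighted distance-hereditary graphs are defined to be the weighted stable graphs. Let $M_G$ be the weighted adjacency matrix of $(G,w)$ (entry $w(uv)$ for edges $uv$, $0$ otherwise). For $A\subseteq V$, the cut rank of $A$ is the rank of the submatrix of $M_G$ with columns indexed by $A$ and rows indexed by $V\setminus A$. For a tree $T$ whose leaves are exactly the vertices of $G$ and all of whose other vertices have degree $3$, each edge $e$ of $T$ splits the leaves into the two sides $A(e),B(e)$ of $T\setminus e$; the width of $e$ is the cut rank of $A(e)$ (equal to that of $B(e)$). The width of $(G,w)$ is the minimum over all such trees $T$ of the maximum width of an edge of $T$. *)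

(* Defs.v *)
From HB Require Import structures.
From mathcomp Require Import all_boot all_order all_algebra.
From mathcomp Require Import boolp reals.
From mathcomp Require Import complex.
From mathcomp Require Import mpoly.

Set Implicit Arguments.
Unset Strict Implicit.
Unset Printing Implicit Defensive.

Import Order.TTheory GRing.Theory Num.Theory.

Local Open Scope ring_scope.

(* A graph with vertex type V is given by its edge set E : {set {set V}};   *)
(* it is simple when every edge is a set of exactly two vertices.           *)
Section Graphs.
Variable V : finType.
Implicit Types E F : {set {set V}}.

Definition simple_graph E : Prop := forall e, e \in E -> #|e| = 2%N.

Definition adj E : rel V := [rel u v | [set u; v] \in E].

Definition deg E (v : V) : nat := #|[set e in E | v \in e]|.

Definition connected_graph E : Prop := forall u v : V, connect (adj E) u v.

Definition acyclic_graph E : Prop :=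
  forall c : seq V, (2 < size c)%N -> uniq c -> ~ cycle (adj E) c.

Definition is_tree E : Prop :=
  [/\ simple_graph E, connected_graph E & acyclic_graph E].

Definition spanning_trees E : {set {set {set V}}} :=
  [set F : {set {set V}} | (F \subset E) && `[< is_tree F >]].

End Graphs.

Section Stability.
Variable R : realType.

Definition real_stable (n : nat) (p : {mpoly R[n]}) : Prop :=
  forall z : 'I_n -> R[i],
    (forall i, 0 < complex.Im (z i)) -> (map_mpoly (real_complex R) p).@[z] != 0.

Variable V : finType.
Implicit Types (E : {set {set V}}) (w : {set V} -> R).

(* The variable x_v is 'X_(enum_rank v).  The natural-number predecessor    *)
(* deg - 1 is the true one as soon as #|V| >= 2, since then every vertex of *)
(* a spanning tree has positive degree.  Here and below only the values of  *)
(* w on E matter.                                                           *)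
Definition vertex_spanning_poly E w : {mpoly R[#|V|]} :=
  \sum_(F in spanning_trees E)
    (\prod_(e in F) w e) *: \prod_(v : V) 'X_(enum_rank v) ^+ (deg F v).-1.

Definition weighted_stable E w : Prop :=
  real_stable (vertex_spanning_poly E w).

End Stability.

Section Width.
Variable R : realType.
Variable V : finType.
Implicit Types (E : {set {set V}}) (w : {set V} -> R).

Definition weighted_adjmx E w : 'M[R]_#|V| :=
  \matrix_(i, j) let e := [set enum_val i; enum_val j] in
                 if e \in E then w e else 0.

Definition cut_rank E w (A : {set V}) : nat :=
  \rank (mxsub (fun i : 'I_#|~: A| => enum_rank (enum_val i))
               (fun j : 'I_#|A| => enum_rank (enum_val j))
               (weighted_adjmx E w)).

(* A tree whose leaves are identified with the vertices of the graph by the *)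
(* injection [leaf], all other nodes having degree 3.                       *)
Record leaf_tree := LeafTree {
  node : finType;
  tree_edges : {set {set node}};
  leaf : V -> node;
  tree_edgesP : is_tree tree_edges;
  leaf_inj : injective leaf;
  leafP : forall x : node, deg tree_edges x = 1%N <-> exists v, x = leaf v;
  innerP : forall x : node, deg tree_edges x <> 1%N -> deg tree_edges x = 3%N
}.

(* The graph vertices lying, in T minus the edge e, in the component of a.  *)
Definition side (T : leaf_tree) (e : {set node T}) (a : node T) : {set V} :=
  [set v | connect (adj (tree_edges T :\ e)) a (leaf T v)].

(* The maximum ranges over the two ends of e, hence over the two sides; their *)
(* cut ranks coincide, the two submatrices being transposes of each other.    *)
Definition edge_width E w (T : leaf_tree) (e : {set node T}) : nat :=
  \max_(a in e) cut_rank E w (side e a).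

Definition tree_width E w (T : leaf_tree) : nat :=
  \max_(e in tree_edges T) edge_width E w e.

(* k is the minimum of [tree_width E w T] over all T. *)
Definition has_width E w (k : nat) : Prop :=
  (exists T : leaf_tree, tree_width E w T = k) /\
  (forall T : leaf_tree, (k <= tree_width E w T)%N).

End Width.

(* Main.v *)
Require Import Defs.
From mathcomp Require Import all_boot all_order all_fingroup all_algebra.
From mathcomp Require Import boolp reals complex mpoly.
From mathcomp Require Import ring lra zify.

(**
By the matrix-tree theorem the polynomial vanishes at [x] in the open upper half-plane iff the
equations [sum_j w_ij x_j (z_j - z_i) = 0] (all [i]) have a nonconstant solution [z]. So stability
says that for all such [x] only constants solve them ([rigid]).

Call [u], [v] twins in a set of vertices when the rows of [u] and [v] are proportional on the rest
of the set. If every set with at least two vertices has twins, then the graph is stable: twins force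
[z_u = z_v], and [u] is absorbed into [v] by replacing [x_v] with [x_v + c x_u]. A tree of width 1
provides twins, because every set of more than three vertices meets some side of the tree in exactly
two vertices.

For the converse, let [N = (t - M)^-1] with [t] large. It has positive entries, and the same
off-diagonal blocks of rank one as [M]. If [(x, z)] solves the equations for [N], then [(N x, z)]
solves them for [M], so [N] is rigid as well, and by a Hurwitz argument so are its restrictions to
subsets. For four vertices this forces two of [N_12 N_34], [N_13 N_24], [N_14 N_23] to agree.
Rescaled so that some vertex [q] has all its weights equal to 1, [N] is then an edge colouring
without rainbow triangles and without two-coloured paths on four vertices; such a colouring has two
vertices of equal distance to all others, that is, twins. Splitting off twins one at a time builds
the tree.
*)

Set Implicit Arguments.
Unset Strict Implicit.
Unset Printing Implicit Defensive.

Import Order.TTheory GRing.Theory Num.Theory.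

Local Open Scope ring_scope.
Local Open Scope complex_scope.

(** * Matrices indexed by a finite type *)

Section FinMatrix.
Variables (K : comNzRingType) (V : finType).
Implicit Types (b : V -> V -> K) (h : V -> nat).

Definition finmx b : 'M[K]_#|V| := \matrix_(i, j) b (enum_val i) (enum_val j).

Definition findet b : K := \det (finmx b).

Lemma big_enum_rankT (T : Type) (idx : T) (op : Monoid.com_law idx) (F : 'I_#|V| -> T) :
  \big[op/idx]_k F k = \big[op/idx]_v F (enum_rank v).
Proof. exact: reindex (onW_bij _ (enum_rank_bij V)). Qed.

Lemma finmxE b i j : finmx b (enum_rank i) (enum_rank j) = b i j.
Proof. by rewrite mxE !enum_rankK. Qed.

Lemma eq_findet b b' : b =2 b' -> findet b = findet b'.
Proof. by move=> bb; congr (\det _); apply/matrixP => i j; rewrite !mxE bb. Qed.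

Lemma findetE b : findet b =
  \sum_(s : 'S_#|V|) (-1) ^+ s * \prod_(v : V) b v (enum_val (s (enum_rank v))).
Proof.
apply: eq_bigr => s _; congr (_ * _); rewrite big_enum_rankT.
by apply: eq_bigr => v _; rewrite mxE enum_rankK.
Qed.

Lemma sum_mul_delta (i : V) (z : V -> K) : \sum_j (i == j)%:R * z j = z i.
Proof.
rewrite (bigD1 i) //= eqxx mul1r big1 ?addr0 // => j ji.
by rewrite eq_sym (negPf ji) mul0r.
Qed.

(* A permutation that does not increase heights preserves them, since it preserves their sum. *)
Lemma findet_triangular b h :
  (forall i j, i != j -> b i j != 0 -> (h j < h i)%N) -> findet b = \prod_i b i i.
Proof.
move=> hb; rewrite findetE (bigD1 1%g) //= odd_perm1 expr0 mul1r [X in _ + X]big1 ?addr0.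
  by apply: eq_bigr => v _; rewrite perm1 enum_rankK.
move=> s s1; pose t v := enum_val (s (enum_rank v)).
have [/existsP [v /eqP bv]|] := boolP [exists v, b v (t v) == 0].
  by rewrite (bigD1 v) //= bv mul0r mulr0.
rewrite negb_exists => /forallP nz; case/eqP: s1.
have tinj : injective t by move=> u v /enum_val_inj /perm_inj /enum_rank_inj.
have ht v : (h (t v) <= h v ?= iff (v == t v))%N.
  have [<-|vt] := eqVneq v (t v); first by split; rewrite ?eqxx.
  by split; [exact: ltnW (hb _ _ vt (nz v))|rewrite ltn_eqF ?hb ?nz].
have /leqif_sum [_] : forall v, true -> (h (t v) <= h v ?= iff (v == t v))%N by [].
rewrite [X in _ == X](reindex_inj tinj) eqxx => /esym /forallP fix_t.
apply/permP => k; rewrite perm1; apply: enum_val_inj.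
by have /eqP := fix_t (enum_val k); rewrite /t enum_valK.
Qed.

End FinMatrix.

Lemma findet_map (K K' : comNzRingType) (V : finType) (phi : {rmorphism K -> K'}) (b : V -> V -> K) :
  phi (findet b) = findet (fun i j => phi (b i j)).
Proof. by rewrite /findet -det_map_mx; congr (\det _); apply/matrixP => i j; rewrite !mxE. Qed.

Section FinMatrixField.
Variables (K : fieldType) (V : finType).
Implicit Types (b : V -> V -> K) (A B : {set V}).

Lemma findet0P b :
  reflect (exists2 z : V -> K, exists v, z v != 0 & forall i, \sum_j b i j * z j = 0)
          (findet b == 0).
Proof.
rewrite /findet -det_tr; apply: (iffP det0P) => [[z /rV0Pn [k zk] zb]|[z [v zv] zb]].
  exists (fun v => z 0 (enum_rank v)); first by exists (enum_val k); rewrite enum_valK.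
  move=> i; have /matrixP /(_ 0 (enum_rank i)) := zb; rewrite !mxE big_enum_rankT => zbi.
  by rewrite -[RHS]zbi; apply: eq_bigr => j _; rewrite !mxE !enum_rankK mulrC.
exists (\row_k z (enum_val k)); first by apply/rV0Pn; exists (enum_rank v); rewrite mxE enum_rankK.
apply/matrixP => i k; rewrite !mxE big_enum_rankT -[RHS](zb (enum_val k)).
by apply: eq_bigr => j _; rewrite !mxE enum_rankK mulrC.
Qed.

Definition fininv b (i j : V) : K := invmx (finmx b) (enum_rank i) (enum_rank j).

Lemma finmx_inv b : finmx (fininv b) = invmx (finmx b).
Proof. by apply/matrixP => i j; rewrite mxE /fininv !enum_valK. Qed.

Lemma mul_fininv b i j : findet b != 0 -> \sum_k b i k * fininv b k j = (i == j)%:R.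
Proof.
rewrite /findet -unitfE -unitmxE => /mulmxV /matrixP /(_ (enum_rank i) (enum_rank j)).
rewrite !mxE (inj_eq enum_rank_inj) big_enum_rankT => <-.
by apply: eq_bigr => k _; rewrite finmxE.
Qed.

Lemma fininvC b i j : (forall i j, b i j = b j i) -> fininv b i j = fininv b j i.
Proof.
move=> bC; have bT : (finmx b)^T = finmx b by apply/matrixP => k l; rewrite !mxE bC.
by rewrite /fininv -{1}bT -trmx_inv mxE.
Qed.

Definition rank_le1 b A B : Prop :=
  forall i i' k k', i \in A -> i' \in A -> k \in B -> k' \in B ->
    b i k * b i' k' = b i k' * b i' k.

Lemma rank_le1C b A B : (forall i j, b i j = b j i) -> rank_le1 b A B -> rank_le1 b B A.
Proof.
move=> bC rk i i' k k' iB i'B kA k'A.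
by rewrite (bC i k) (bC i' k') (bC i k') (bC i' k) (rk k k' i i') // mulrC.
Qed.

Lemma rank_le1S b A B A' B' : A' \subset A -> B' \subset B -> rank_le1 b A B -> rank_le1 b A' B'.
Proof. by move=> /subsetP sA /subsetP sB rk i i' k k' *; apply: rk; auto. Qed.

Lemma rank_le1_card b A B : (#|A| <= 1)%N -> rank_le1 b A B.
Proof. by move=> /card_le1_eqP A1 i i' k k' iA i'A _ _; rewrite (A1 i i') // mulrC. Qed.

Lemma rank_le1_pullback b b' (phi : V -> V) (g h : V -> K) A B A' B' :
  {in A', forall i, phi i \in A} -> {in B', forall k, phi k \in B} ->
  {in A' & B', forall i k, b' i k = g i * h k * b (phi i) (phi k)} ->
  rank_le1 b A B -> rank_le1 b' A' B'.
Proof.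
move=> phiA phiB b'E rk i i' k k' iA i'A kB k'B; rewrite !b'E //.
transitivity (g i * h k * g i' * h k' * (b (phi i) (phi k) * b (phi i') (phi k'))); first by ring.
by rewrite (rk _ _ _ _ (phiA _ iA) (phiA _ i'A) (phiB _ kB) (phiB _ k'B)); ring.
Qed.

Lemma mxrank_le1P m n (A : 'M[K]_(m, n)) :
  (\rank A <= 1)%N <-> forall i i' k k', A i k * A i' k' = A i k' * A i' k.
Proof.
split=> [|minors0].
  have := esym (mulmx_base A).
  move: (\rank A) (col_base A) (row_base A) => [|[|q]] C D -> // _ i i' k k'.
    by rewrite !mxE !big_ord0 !mul0r.
  by rewrite !mxE !big_ord1; ring.
have [->|/matrix0Pn [i [k ik]]] := eqVneq A 0; first by rewrite mxrank0.
have -> : A = col k A *m ((A i k)^-1 *: row i A).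
  apply/matrixP => i' k'; rewrite !mxE big_ord1 !mxE.
  by rewrite mulrCA (minors0 i' i k k') mulrC mulfK.
exact: leq_trans (mxrankM_maxl _ _) (rank_leq_col _).
Qed.

(* Adding rank Q to both sides gives the ranks of [Q + Q M^-1] and [Q + Q M], and
   multiplication by M takes the first space to the second. *)
Lemma mxrank_offdiag_inv n (M Q : 'M[K]_n) : M \in unitmx -> Q *m Q = Q ->
  \rank (Q *m invmx M *m (1%:M - Q)) = \rank (Q *m M *m (1%:M - Q)).
Proof.
move=> uM QQ.
have rank_sum X : \rank (Q + Q *m X)%MS = (\rank Q + \rank (Q *m X *m (1%:M - Q)))%N.
  have decomp : Q *m X *m (1%:M - Q) = Q *m X - Q *m X *m Q by rewrite mulmxBr mulmx1.
  have -> : (Q + Q *m X :=: Q + Q *m X *m (1%:M - Q))%MS.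
    apply/eqmxP; rewrite decomp !addsmx_sub !addsmxSl /=; apply/andP; split.
      rewrite -[X in (X <= _)%MS](subrK (Q *m X *m Q)) addmx_sub //; first exact: addsmxSr.
      exact: submx_trans (submxMl _ _) (addsmxSl _ _).
    rewrite addmx_sub ?addsmxSr // -mulNmx.
    exact: submx_trans (submxMl _ _) (addsmxSl _ _).
  apply/mxrank_disjoint_sum/eqP; rewrite -submx0; apply/rV_subP => u.
  rewrite sub_capmx => /andP [/submxP [D ->] /submxP [D' e]].
  by rewrite -QQ mulmxA e -!mulmxA mulmxBl mul1mx QQ subrr !mulmx0 sub0mx.
apply/eqP; rewrite -(eqn_add2l (\rank Q)) -!rank_sum.
rewrite -(mxrankMfree (Q + Q *m invmx M)%MS (B := M)) ?row_free_unit //.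
by rewrite addsmxMr -mulmxA mulVmx // mulmx1 addsmxC.
Qed.

Lemma rank_le1_offdiagE b A : rank_le1 b A (~: A) <->
  (\rank (diag_mx (\row_k (enum_val k \in A)%:R) *m finmx b
            *m (1%:M - diag_mx (\row_k (enum_val k \in A)%:R)) : 'M_#|V|) <= 1)%N.
Proof.
set Q := diag_mx _; rewrite mxrank_le1P.
have entryE i j : (Q *m finmx b *m (1%:M - Q)) (enum_rank i) (enum_rank j) =
    (i \in A)%:R * b i j * (j \in ~: A)%:R.
  rewrite mulmxBr mulmx1 mul_mx_diag mul_diag_mx !mxE !enum_rankK in_setC.
  by case: (j \in A); rewrite ?mulr1 ?mulr0 ?subr0 ?subrr.
split=> [rk k k' l l'|minors0 i i' j j' iA i'A jA j'A].
  rewrite -(enum_valK k) -(enum_valK k') -(enum_valK l) -(enum_valK l') !entryE.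
  case: (boolP (_ \in A)) => ?; case: (boolP (_ \in A)) => ?;
    case: (boolP (_ \in ~: A)) => ?; case: (boolP (_ \in ~: A)) => ?;
    by rewrite ?(mulr0, mul0r, mulr1, mul1r) //; apply: rk.
have := minors0 (enum_rank i) (enum_rank i') (enum_rank j) (enum_rank j').
by rewrite !entryE iA i'A jA j'A !mul1r !mulr1.
Qed.

Lemma rank_le1_fininv b A : findet b != 0 ->
  rank_le1 (fininv b) A (~: A) <-> rank_le1 b A (~: A).
Proof.
rewrite /findet -unitfE -unitmxE => ub.
rewrite !rank_le1_offdiagE finmx_inv mxrank_offdiag_inv //.
apply/matrixP => i j; rewrite mul_diag_mx !mxE.
by case: (_ \in A); rewrite ?mul1r ?mul0r ?mul0rn.
Qed.

End FinMatrixField.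

(** * Rooted functions and spanning trees *)

Lemma set2_eq (T : finType) (i j k l : T) :
  [set i; j] = [set k; l] -> (i = k /\ j = l) \/ (i = l /\ j = k).
Proof.
move=> e.
have /set2P hi : i \in [set k; l] by rewrite -e set21.
have /set2P hj : j \in [set k; l] by rewrite -e set22.
have /set2P hk : k \in [set i; j] by rewrite e set21.
have /set2P hl : l \in [set i; j] by rewrite e set22.
case: hi hj hk hl => -> [] -> [] ? [] ?; subst; by auto.
Qed.

Section Adjacency.
Variable V : finType.
Implicit Types (F : {set {set V}}) (u v : V).

Lemma adjC F : ssrbool.symmetric (adj F).
Proof. by move=> u v; rewrite /adj /= setUC. Qed.

Lemma connect_adjC F : connect_sym (adj F).
Proof. by apply: sym_connect_sym; exact: adjC. Qed.

Lemma tree_edge_bridge F u v : is_tree F -> [set u; v] \in F ->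
  ~~ connect (adj (F :\ [set u; v])) u v.
Proof.
move=> [sF _ aF] uvF; apply/negP => /connectP [p pp vE].
case/shortenP: pp vE => p' pp' up' _ vE.
have uNv : u != v by have := sF _ uvF; rewrite cards2; case: eqVneq.
apply: (aF (u :: p')) => //.
  case: p' pp' up' vE => [|x [|y p']] //=; first by move=> _ _ vE; rewrite vE eqxx in uNv.
  by move=> /andP [ux _] _ vE; move: ux; rewrite -vE /adj /= !inE eqxx.
rewrite /= rcons_path -vE adjC; apply/andP; split=> //.
by apply: sub_path pp' => x y; rewrite /adj /= !inE => /andP [].
Qed.

End Adjacency.

Section RootedFunctions.
Variables (V : finType) (r : V).
Implicit Types (f g : V -> V) (F : {set {set V}}).

Definition rooted f : bool := (f r == r) && [forall i, fconnect f i r].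

Definition parent_edges f : {set {set V}} := [set [set i; f i] | i in predC1 r].

Lemma rooted_root f : rooted f -> f r = r.
Proof. by case/andP=> /eqP. Qed.

Lemma fconnect_root f y : rooted f -> fconnect f r y = (y == r).
Proof.
move=> /rooted_root fr; apply/idP/eqP => [/iter_findex <-|->]; last exact: connect0.
by elim: (findex _ _ _) => //= k ->.
Qed.

Lemma rootedP f :
  reflect (f r = r /\ exists h : V -> nat, forall i, i != r -> (h (f i) < h i)%N) (rooted f).
Proof.
apply: (iffP andP) => [[/eqP fr /forallP reach]|[fr [h hf]]].
  split=> //; have depth i : exists k, iter k f i == r.
    by exists (findex f i r); rewrite iter_findex.
  exists (fun i => ex_minn (depth i)) => i ir.
  case: (ex_minnP (depth i)) => -[|k] /eqP ki _; first by rewrite -ki eqxx in ir.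
  by case: (ex_minnP (depth (f i))) => m _; apply; rewrite -iterSr ki.
split; first exact/eqP; apply/forallP => i.
have [n] := ubnP (h i); elim: n i => // n IH i hi.
have [->|ir] := eqVneq i r; first exact: connect0.
apply: connect_trans (fconnect1 f i) (IH _ _).
exact: leq_trans (hf i ir) hi.
Qed.

Lemma rooted_ind f (P : V -> Prop) :
  rooted f -> P r -> (forall i, i != r -> P (f i) -> P i) -> forall i, P i.
Proof.
move=> /rootedP [_ [h hf]] Pr Pf i; have [n] := ubnP (h i); elim: n i => // n IH i hi.
have [->|ir] := eqVneq i r; first exact: Pr.
by apply: (Pf i ir (IH _ _)); apply: leq_trans (hf i ir) hi.
Qed.

Lemma rooted_parent_not_descendant f i : rooted f -> i != r -> ~~ fconnect f (f i) i.
Proof.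
move=> /rootedP [fr [h hf]] ir; apply/negP => /iter_findex; move: (findex _ _ _) => k ki.
have iter_le n x : (h (iter n f x) <= h x)%N.
  elim: n => //= n; apply: leq_trans.
  by have [->|/hf /ltnW] := eqVneq (iter n f x) r; rewrite ?fr.
by have := hf i ir; rewrite ltnNge -{1}ki iter_le.
Qed.

Lemma rooted_neq f i : rooted f -> i != r -> f i != i.
Proof. by move=> rf /(rooted_parent_not_descendant rf); apply: contraNneq => ->. Qed.

Lemma parent_edgesP f e :
  reflect (exists2 i, i != r & e = [set i; f i]) (e \in parent_edges f).
Proof. by apply: (iffP imsetP) => -[i ir ->]; exists i. Qed.

Lemma parent_edge_inj f : rooted f -> {in predC1 r &, injective (fun i => [set i; f i])}.
Proof.
move=> /rootedP [_ [h hf]] i j; rewrite !inE => ir jr /set2_eq [] [] // ij fij.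
by have := hf i ir; have := hf j jr; rewrite fij -ij; lia.
Qed.

Lemma adj_parent_edges f u v :
  adj (parent_edges f) u v -> (u != r /\ v = f u) \/ (v != r /\ u = f v).
Proof. by case/parent_edgesP=> i ir /set2_eq [] [-> ->]; auto. Qed.

Lemma adj_parent f i : i != r -> adj (parent_edges f) i (f i).
Proof. by move=> ir; apply/parent_edgesP; exists i. Qed.

Lemma parent_edges_connected f : rooted f -> connected_graph (parent_edges f).
Proof.
move=> rf; have to_root : forall i, connect (adj (parent_edges f)) i r.
  apply: (rooted_ind rf) => // i ir; exact: connect_trans (connect1 (adj_parent f ir)).
by move=> u v; apply: connect_trans (to_root u) _; rewrite connect_adjC.
Qed.

(* Both neighbours of a highest vertex on a cycle would be its parent. *)
Lemma parent_edges_acyclic f : rooted f -> acyclic_graph (parent_edges f).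
Proof.
move=> rf c c3 uc cc; have /rootedP [_ [h hf]] := rf.
have [x0 x0c] : exists x0, x0 \in c by case: c c3 {uc cc} => // x0 c _; exists x0; rewrite mem_head.
case: (@arg_maxnP _ x0 (mem c) h x0c) => x xc xmax.
have parent y : y \in c -> adj (parent_edges f) x y -> y = f x.
  move=> yc /adj_parent_edges [[]//|[yr xy]].
  by have := leq_trans (hf y yr) (xmax y yc); rewrite -xy ltnn.
have [i c' cE] := rot_to xc.
move: cc uc c3; rewrite -(rot_cycle i) -(rot_uniq i) -(size_rot i) cE.
have inc z : z \in x :: c' -> z \in c by rewrite -cE mem_rot.
case: c' inc {cE} => // y c'; case/lastP: c' => // c' z inc /=.
rewrite rcons_path last_rcons (adjC _ z) => /and3P [xy _ xz] /and3P [_ yz _] _.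
have yE : y = f x by apply: parent xy; apply: inc; rewrite !inE eqxx orbT.
have zE : z = f x by apply: parent xz; apply: inc; rewrite !inE mem_rcons mem_head !orbT.
by rewrite yE zE mem_rcons mem_head in yz.
Qed.

Lemma parent_edges_tree f : rooted f -> is_tree (parent_edges f).
Proof.
move=> rf; split; [|exact: parent_edges_connected|exact: parent_edges_acyclic].
by move=> e /parent_edgesP [i ir ->]; rewrite cards2 eq_sym rooted_neq.
Qed.

Lemma parent_edges_inj f g :
  rooted f -> rooted g -> parent_edges f = parent_edges g -> f =1 g.
Proof.
move=> rf rg fg; have /rootedP [_ [h hf]] := rf.
apply: (rooted_ind rf) => [|i ir IH]; first by rewrite !rooted_root.
have := adj_parent f ir; rewrite fg => /adj_parent_edges [[]//|[fir iE]].
have ffi : f (f i) = i by rewrite IH -iE.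
by have := hf (f i) fir; have := hf i ir; rewrite ffi; lia.
Qed.

Section Distance.
Variables (F : {set {set V}}) (cF : connected_graph F).

Lemma walk_to_root i : exists k, [exists p : k.-tuple V, path (adj F) i p && (last i p == r)].
Proof.
have /connectP [p pp rl] := cF i r.
by exists (size p); apply/existsP; exists (in_tuple p); rewrite pp -rl eqxx.
Qed.

Definition dist_root i : nat := ex_minn (walk_to_root i).

Lemma closer_neighbour i :
  i != r -> exists j, adj F i j && (dist_root j < dist_root i)%N.
Proof.
move=> ir; rewrite /dist_root.
case: (ex_minnP (walk_to_root i)) => k /existsP [[p /= /eqP <-] /= /andP [+ /eqP +]].
case: p => [|j p] /=; first by move=> _ iE; rewrite iE eqxx in ir.
case/andP=> ij pp lp _; exists j; rewrite ij.
case: (ex_minnP (walk_to_root j)) => m _; apply.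
by apply/existsP; exists (in_tuple p); rewrite pp lp eqxx.
Qed.

End Distance.

Lemma connected_rooted F : connected_graph F ->
  exists2 f : {ffun V -> V}, rooted f & forall i, i != r -> [set i; f i] \in F.
Proof.
move=> cF; pose closer i j := adj F i j && (dist_root cF j < dist_root cF i)%N.
pose f := [ffun i => if i == r then r else odflt r [pick j | closer i j]].
have closerf i : i != r -> closer i (f i).
  move=> ir; rewrite ffunE (negPf ir); case: pickP => //= no.
  by have [j] := closer_neighbour cF ir; rewrite -/(closer i j) no.
exists f => [|i /closerf /andP [] //].
apply/rootedP; split; first by rewrite ffunE eqxx.
by exists (dist_root cF) => i /closerf /andP [].
Qed.

Lemma tree_parent_edges F : is_tree F ->
  exists2 f : {ffun V -> V}, rooted f & F = parent_edges f.
Proof.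
move=> tF; have [sF cF _] := tF; have [f rf fF] := connected_rooted cF.
have fsub : parent_edges f \subset F by apply/subsetP => e /parent_edgesP [i ir ->]; exact: fF.
exists f => //; apply/eqP; rewrite eqEsubset fsub andbT.
apply/subsetP => e eF; apply: contraT => nef.
have /eqP/cards2P [u [v [_ eE]]] := sF e eF; subst e.
rewrite -(negPf (tree_edge_bridge tF eF)).
apply: (connect_sub _ (parent_edges_connected rf u v)) => x y xy.
apply: connect1; rewrite /adj /= !inE (subsetP fsub) // andbT.
by apply: contraNneq nef => <-.
Qed.

Lemma sum_spanning_trees_rooted (K : comNzRingType) (E : {set {set V}}) (g : {set V} -> K) :
  \sum_(F in spanning_trees E) \prod_(e in F) g e =
  \sum_(f : {ffun V -> V} | rooted f && [forall (i | i != r), [set i; f i] \in E])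
     \prod_(i | i != r) g [set i; f i].
Proof.
pose parents_in_E := [set f : {ffun V -> V} | rooted f && [forall (i | i != r), [set i; f i] \in E]].
have -> : spanning_trees E = [set parent_edges f | f : {ffun V -> V} in parents_in_E].
  apply/setP => F; rewrite inE; apply/andP/imsetP => [[FE /asboolP tF]|[f]].
    have [f rf Ff] := tree_parent_edges tF; exists f => //.
    rewrite inE rf; apply/forall_inP => i ir; apply: (subsetP FE).
    by rewrite Ff; apply/parent_edgesP; exists i.
  rewrite inE => /andP [rf /forall_inP fE] ->; split.
    by apply/subsetP => e /parent_edgesP [i ir ->]; exact: fE.
  by apply/asboolP; exact: parent_edges_tree.
rewrite big_imset /=; last first.
  move=> f1 f2; rewrite !inE => /andP [r1 _] /andP [r2 _] e; apply/ffunP.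
  exact: parent_edges_inj.
under eq_bigl do rewrite inE.
by apply: eq_bigr => f /andP [rf _]; rewrite big_imset //=; exact: parent_edge_inj.
Qed.

End RootedFunctions.

(** * The matrix-tree theorem *)

Definition rooted_laplacian (K : comNzRingType) (V : finType) (r : V) (c : V -> V -> K) (i j : V) : K :=
  if i == r then (i == j)%:R else (\sum_k c i k) * (i == j)%:R - c i j.

Lemma eq_rooted_laplacian (K : comNzRingType) (V : finType) (r : V) (c c' : V -> V -> K) :
  c =2 c' -> rooted_laplacian r c =2 rooted_laplacian r c'.
Proof. by move=> cc i j; rewrite /rooted_laplacian cc; under eq_bigr do rewrite cc. Qed.

Lemma rooted_laplacian_map (K K' : comNzRingType) (V : finType) (phi : {rmorphism K -> K'})
    (r : V) (c : V -> V -> K) (i j : V) :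
  phi (rooted_laplacian r c i j) = rooted_laplacian r (fun i j => phi (c i j)) i j.
Proof.
rewrite /rooted_laplacian; case: ifP => _; first by rewrite rmorph_nat.
by rewrite rmorphB rmorphM rmorph_nat rmorph_sum.
Qed.

Section MatrixTree.
Variables (K : fieldType) (V : finType) (r : V).
Implicit Types (c : V -> V -> K) (f : V -> V).

Let parent_step (i k j : V) : K := (i == j)%:R - (i != r)%:R * (k == j)%:R.

Lemma findet_parent_step_rooted f : rooted r f -> findet (fun i => parent_step i (f i)) = 1.
Proof.
move=> rf; have /rootedP [_ [h hf]] := rf.
rewrite (findet_triangular (h := h)) => [|i j ij].
  rewrite big1 // => i _; rewrite /parent_step eqxx.
  have [->|ir] := eqVneq i r; first by rewrite mul0r subr0.
  by rewrite (negPf (rooted_neq rf ir)) mulr0 subr0.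
rewrite /parent_step (negPf ij) sub0r oppr_eq0.
have [->|ir] := eqVneq i r; first by rewrite mul0r eqxx.
by have [<- _|_] := eqVneq (f i) j; [exact: hf|rewrite mulr0 eqxx].
Qed.

Lemma findet_parent_step_unrooted f :
  f r = r -> ~~ rooted r f -> findet (fun i => parent_step i (f i)) = 0.
Proof.
move=> fr; rewrite /rooted fr eqxx negb_forall => /existsP [i0 i0r].
apply/eqP/findet0P; exists (fun i => (~~ fconnect f i r)%:R).
  by exists i0; rewrite i0r oner_neq0.
move=> i; under eq_bigr do rewrite mulrBl -mulrA.
rewrite sumrB -mulr_sumr !sum_mul_delta.
have [->|ir] := eqVneq i r; first by rewrite connect0 mul0r subrr.
by rewrite (fconnect_eqVf f i) (negPf ir) mul1r subrr.
Qed.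

Lemma findet_rooted_laplacian c :
  findet (rooted_laplacian r c) =
  \sum_(f : {ffun V -> V} | rooted r f) \prod_(i | i != r) c i (f i).
Proof.
pose cr i k := if i == r then (k == r)%:R else c i k.
have rowE i j : rooted_laplacian r c i j = \sum_k cr i k * parent_step i k j.
  rewrite /rooted_laplacian /cr /parent_step; have [ir|ir] := boolP (i == r).
    under eq_bigr do rewrite mul0r subr0 (eq_sym _ r).
    by rewrite sum_mul_delta.
  under [RHS]eq_bigr => k _ do rewrite mul1r mulrBr (eq_sym k) [X in _ - X]mulrC.
  by rewrite sumrB -mulr_suml sum_mul_delta.
rewrite (eq_findet rowE) findetE.
under eq_bigr => s _ do rewrite bigA_distr_bigA big_distrr /=.
rewrite exchange_big [RHS]big_mkcond /=; apply: eq_bigr => f _.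
transitivity ((\prod_i cr i (f i)) * findet (fun i => parent_step i (f i))).
  rewrite findetE big_distrr /=; apply: eq_bigr => s _.
  by rewrite big_split /= mulrCA.
have [fr|fr] := eqVneq (f r) r; last first.
  by rewrite /rooted (negPf fr) (bigD1 r) //= {1}/cr eqxx (negPf fr) !mul0r.
case: ifPn => [rf|/(findet_parent_step_unrooted fr) ->]; last by rewrite mulr0.
rewrite findet_parent_step_rooted // mulr1 (bigD1 r) //= {1}/cr eqxx fr eqxx mul1r.
by apply: eq_bigr => i ir; rewrite /cr (negPf ir).
Qed.

Lemma rooted_laplacian0P c :
  reflect (exists2 z : V -> K, exists v, z v != z r &
             forall i, i != r -> \sum_j c i j * (z j - z i) = 0)
          (findet (rooted_laplacian r c) == 0).
Proof.
have rowE (z : V -> K) i : i != r ->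
    \sum_j rooted_laplacian r c i j * z j = - \sum_j c i j * (z j - z i).
  move=> ir; rewrite /rooted_laplacian (negPf ir).
  under eq_bigr do rewrite mulrBl -mulrA.
  rewrite sumrB -mulr_sumr sum_mul_delta mulr_suml -sumrB -sumrN.
  by apply: eq_bigr => j _; rewrite mulrBr opprB.
have rowr (z : V -> K) : \sum_j rooted_laplacian r c r j * z j = z r.
  by rewrite /rooted_laplacian eqxx sum_mul_delta.
apply: (iffP (findet0P _)) => [[z [v vz] eqz]|[z [v vz] eqz]].
  exists z; first by exists v; rewrite -[z r]rowr eqz.
  by move=> i ir; apply/eqP; rewrite -oppr_eq0 -rowE // eqz.
exists (fun j => z j - z r); first by exists v; rewrite subr_eq0.
move=> i; have [->|ir] := eqVneq i r; first by rewrite rowr subrr.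
rewrite rowE //; under eq_bigr do rewrite opprB addrA subrK.
by rewrite eqz // oppr0.
Qed.

End MatrixTree.

(** * Stability as rigidity *)

Section UpperHalfPlane.
Variable R : rcfType.
Implicit Types (a : R) (y : R[i]).

Definition upper y : bool := 0 < complex.Im y.

Lemma ImD y y' : complex.Im (y + y') = complex.Im y + complex.Im y'.
Proof. by case: y y' => [? ?] [? ?]. Qed.

Lemma ImMr a y : complex.Im (a%:C * y) = a * complex.Im y.
Proof. by case: y => ? ?; rewrite /= mul0r addr0. Qed.

Lemma upper_neq0 y : upper y -> y != 0.
Proof. by rewrite /upper; apply: contraTneq => ->; rewrite ltxx. Qed.

Lemma upperM a y : 0 < a -> upper y -> upper (a%:C * y).
Proof. by rewrite /upper ImMr; exact: mulr_gt0. Qed.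

Lemma upper_wsum (I : finType) (P : pred I) (a : I -> R) (y : I -> R[i]) (i0 : I) :
  P i0 -> 0 < a i0 -> (forall i, P i -> 0 <= a i) -> (forall i, P i -> upper (y i)) ->
  upper (\sum_(i | P i) (a i)%:C * y i).
Proof.
move=> Pi0 ai0 a0 uy; rewrite /upper (big_morph (@complex.Im R) ImD (erefl _)) (bigD1 i0) //=.
apply: ltr_wpDr; last by rewrite -/(upper _) upperM ?uy.
by apply: sumr_ge0 => i /andP [Pi _]; rewrite ImMr mulr_ge0 ?a0 // ltW // -/(upper _) uy.
Qed.

End UpperHalfPlane.

Section Balanced.
Variables (R : rcfType) (V : finType).
Implicit Types (W : V -> V -> R) (U : {set V}) (x z : V -> R[i]).

Definition balanced W U x z : Prop :=
  {in U, forall i, \sum_(j in U) (W i j)%:C * x j * (z j - z i) = 0}.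

Definition rigid W U : Prop :=
  forall x z, {in U, forall i, upper (x i)} -> balanced W U x z ->
    {in U &, forall i j, z i = z j}.

Definition laplacian_det W (r : V) x : R[i] :=
  findet (rooted_laplacian r (fun i j => (W i j)%:C * x j)).

Lemma balancedP W U x z : balanced W U x z <->
  {in U, forall i, \sum_(j in U) (W i j)%:C * (x j * z j) = (\sum_(j in U) (W i j)%:C * x j) * z i}.
Proof.
have sumE i : \sum_(j in U) (W i j)%:C * x j * (z j - z i) =
    \sum_(j in U) (W i j)%:C * (x j * z j) - (\sum_(j in U) (W i j)%:C * x j) * z i.
  by rewrite mulr_suml -sumrB; apply: eq_bigr => j _; rewrite mulrBr mulrA.
split=> bal i iU; last by rewrite sumE bal // subrr.
by apply/eqP; rewrite -subr_eq0 -sumE bal.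
Qed.

Lemma sum_setT (F : V -> R[i]) : \sum_(j in [set: V]) F j = \sum_j F j.
Proof. by apply: eq_bigl => j; rewrite inE. Qed.

Lemma balanced_setT W x z :
  balanced W setT x z <-> forall i, \sum_j (W i j)%:C * x j * (z j - z i) = 0.
Proof. by split=> bal i; [have := bal i (in_setT i)|move=> _]; rewrite sum_setT. Qed.

(* The x-weighted sum of all the equations vanishes by symmetry. *)
Lemma balanced_root W (r : V) x z : (forall i j, W i j = W j i) -> x r != 0 ->
  (forall i, i != r -> \sum_j (W i j)%:C * x j * (z j - z i) = 0) ->
  balanced W setT x z.
Proof.
move=> WC xr eqs; apply/balanced_setT => i; have [->|/eqs//] := eqVneq i r.
have : \sum_i x i * (\sum_j (W i j)%:C * x j * (z j - z i)) = 0.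
  pose S := \sum_i \sum_j x i * ((W i j)%:C * x j * z j).
  transitivity (S - S); last exact: subrr.
  rewrite {2}/S exchange_big -sumrB; apply: eq_bigr => k _ /=.
  rewrite mulr_sumr -sumrB; apply: eq_bigr => j _.
  by rewrite (WC j k); ring.
rewrite (bigD1 r) //= [X in _ + X]big1 ?addr0; last by move=> k /eqs ->; rewrite mulr0.
by move/eqP; rewrite mulf_eq0 (negPf xr) => /eqP.
Qed.

Lemma rigid_setTP W (r : V) : (forall i j, W i j = W j i) ->
  rigid W setT <->
  forall x, (forall i, upper (x i)) -> laplacian_det W r x != 0.
Proof.
move=> WC; split=> [rig x ux|nz x z ux /balanced_setT bal].
  apply/rooted_laplacian0P => -[z [v vz] eqs]; case/eqP: vz.
  apply: (rig x) => //; apply: balanced_root eqs => //; exact: upper_neq0.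
suff zr v : z v = z r by move=> i j _ _; rewrite !zr.
apply/eqP; apply: contraT => vz.
have /negP [] := nz x (fun i => ux i (in_setT i)).
by apply/rooted_laplacian0P; exists z; first by exists v.
Qed.

End Balanced.

Section WeightedAdjacency.
Variables (R : numDomainType) (V : finType) (E : {set {set V}}) (w : {set V} -> R).

Definition wadj (i j : V) : R := if [set i; j] \in E then w [set i; j] else 0.

Lemma wadjC i j : wadj i j = wadj j i.
Proof. by rewrite /wadj setUC. Qed.

Lemma wadj_ge0 i j : (forall e, e \in E -> 0 < w e) -> 0 <= wadj i j.
Proof. by move=> w0; rewrite /wadj; case: ifP => // /w0 /ltW. Qed.

End WeightedAdjacency.

Lemma connected_deg_gt0 (V : finType) (F : {set {set V}}) v :
  (1 < #|V|)%N -> connected_graph F -> (0 < deg F v)%N.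
Proof.
move=> V2 cF; have /card_gt0P [u] : (0 < #|[set~ v]|)%N by rewrite cardsC1; lia.
rewrite !inE => uv.
have /connectP [[|a p] /= pp uE] := cF v u; first by rewrite uE eqxx in uv.
by apply/card_gt0P; exists [set v; a]; rewrite inE set21 andbT; case/andP: pp.
Qed.

Section StablePolynomial.
Variables (R : realType) (V : finType) (E : {set {set V}}) (w : {set V} -> R).
Hypothesis V2 : (1 < #|V|)%N.

Lemma meval_vertex_spanning_poly (y : 'I_#|V| -> R[i]) :
  (map_mpoly (real_complex R) (vertex_spanning_poly E w)).@[y] =
  \sum_(F in spanning_trees E)
    (\prod_(e in F) (w e)%:C) * \prod_v y (enum_rank v) ^+ (deg F v).-1.
Proof.
pose toC := real_complex R.
rewrite /vertex_spanning_poly (rmorph_sum (map_mpoly toC)) (rmorph_sum (meval y)).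
apply: eq_bigr => F _; rewrite /= map_mpolyZ mevalZ rmorph_prod; congr (_ * _).
rewrite (rmorph_prod (map_mpoly toC)) (rmorph_prod (meval y)); apply: eq_bigr => v _.
by rewrite (rmorphXn (map_mpoly toC)) (rmorphXn (meval y)) /= map_mpolyX mevalXU.
Qed.

Lemma vertex_spanning_poly_laplacian (r : V) (x : V -> R[i]) : (forall i, x i != 0) ->
  x r * (\sum_(F in spanning_trees E)
    (\prod_(e in F) (w e)%:C) * \prod_v x v ^+ (deg F v).-1) =
  laplacian_det (wadj E w) r x.
Proof.
move=> nx; have nzp : \prod_(i | i != r) x i != 0 by apply/prodf_neq0 => i _.
apply: (mulfI nzp); pose g (e : {set V}) := (w e)%:C * \prod_(v in e) x v.
transitivity (\sum_(F in spanning_trees E) \prod_(e in F) g e).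
  have prodE : \prod_i x i = (\prod_(i | i != r) x i) * x r by rewrite (bigD1 r) //= mulrC.
  rewrite mulrA -prodE big_distrr /=.
  apply: eq_bigr => F; rewrite inE => /andP [_ /asboolP [_ cF _]].
  rewrite /g big_split /= mulrCA; congr (_ * _).
  rewrite [RHS](exchange_big_dep predT) //= -big_split /=; apply: eq_bigr => v _.
  rewrite -exprS prednK ?connected_deg_gt0 // prodr_const; congr (_ ^+ _).
  by apply: eq_card => e; rewrite !inE.
rewrite (sum_spanning_trees_rooted r) /laplacian_det findet_rooted_laplacian big_distrr /=.
rewrite [RHS](bigID (fun f : {ffun V -> V} => [forall (i | i != r), [set i; f i] \in E])) /=.
rewrite [X in _ + X]big1 ?addr0; last first.
  move=> f /andP [_]; rewrite negb_forall_in => /exists_inP [i ir fi].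
  by rewrite [X in _ * X](bigD1 i) //= /wadj (negPf fi) !mul0r mulr0.
apply: eq_bigr => f /andP [rf /forall_inP fE].
rewrite -big_split /=; apply: eq_bigr => i ir.
rewrite /g /wadj fE // big_setU1 ?big_set1; last by rewrite inE eq_sym (rooted_neq rf).
by rewrite mulrCA.
Qed.

Lemma weighted_stable_rigid : weighted_stable E w <-> rigid (wadj E w) setT.
Proof.
have /card_gt0P [r _] : (0 < #|V|)%N by exact: ltnW.
rewrite (rigid_setTP r (wadjC E w)); split=> [stable x ux|nz y uy].
  rewrite -vertex_spanning_poly_laplacian => [|i]; last exact: upper_neq0.
  apply: mulf_neq0; first exact: upper_neq0.
  have := stable (fun k => x (enum_val k)) (fun k => ux (enum_val k)).
  rewrite meval_vertex_spanning_poly.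
  by under eq_bigr do under [X in _ * X]eq_bigr do rewrite enum_rankK.
rewrite meval_vertex_spanning_poly.
have := nz (fun v => y (enum_rank v)) (fun v => uy (enum_rank v)).
rewrite -vertex_spanning_poly_laplacian => [|i]; last exact/upper_neq0/uy.
by rewrite mulf_eq0 negb_or => /andP [].
Qed.

End StablePolynomial.

(** * Rank-one decompositions *)

Section CubicTrees.
Variables (T : finType) (r : T) (f : T -> T).
Implicit Types (x y u v : T).

Definition children x : {set T} := [set y | (y != r) && (f y == x)].

Definition parent_deg x : nat := (#|children x| + (x != r))%N.

Hypothesis rf : rooted r f.

Lemma deg_parent_edges x : deg (parent_edges r f) x = parent_deg x.
Proof.
pose xedges := [set y | (y != r) && (x \in [set y; f y])].
rewrite /deg; have -> : [set e in parent_edges r f | x \in e] = [set [set y; f y] | y in xedges].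
  apply/setP => e; rewrite !inE; apply/andP/imsetP.
    by case=> /parent_edgesP [y yr ->] xe; exists y; rewrite // inE yr.
  by case=> y; rewrite inE => /andP [yr xe] ->; split=> //; apply/parent_edgesP; exists y.
rewrite card_in_imset; last first.
  move=> y y'; rewrite !inE => /andP [yr _] /andP [y'r _].
  by apply: (parent_edge_inj rf); rewrite inE.
rewrite /parent_deg; have [xr|xr] := eqVneq x r.
  rewrite addn0; apply: eq_card => y; rewrite !inE xr !(eq_sym r).
  by case: (eqVneq y r).
have -> : xedges = x |: children x.
  apply/setP => y; rewrite !inE (eq_sym x (f y)).
  by have [->|yx] := eqVneq y x; rewrite ?xr.
by rewrite cardsU1 !inE xr (negPf (rooted_neq rf xr)) addnC.
Qed.

Lemma fconnect_child x y :
  fconnect f x y -> x = y \/ exists2 z, z \in children y & fconnect f x z.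
Proof.
move: x; apply: (rooted_ind rf) => [|x xr IH].
  by rewrite fconnect_root // => /eqP ->; left.
rewrite fconnect_eqVf => /orP [/eqP|/IH [fxy|[z zy fxz]]]; first by left.
  by right; exists x; rewrite // inE xr fxy eqxx.
by right; exists z => //; apply: connect_trans (fconnect1 f x) fxz.
Qed.

Let cut y := parent_edges r f :\ [set y; f y].

Lemma connect_cut_descendant y u v :
  y != r -> connect (adj (cut y)) u v -> fconnect f u y = fconnect f v y.
Proof.
move=> yr uv; apply: (closed_connect (a := [pred x | fconnect f x y])) uv.
have down x : x != r -> [set x; f x] != [set y; f y] -> fconnect f x y = fconnect f (f x) y.
  by move=> xr ne; rewrite fconnect_eqVf; case: (eqVneq x y) ne => // ->; rewrite eqxx.
apply: intro_closed; first exact: connect_adjC.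
move=> a b; rewrite /adj /= !inE => /andP [ne /adj_parent_edges [[ar bE]|[br aE]]].
  by rewrite bE down // -bE.
by rewrite [fconnect f b y]down // -aE // setUC.
Qed.

Lemma adj_cut x y : x != r -> y != r -> x != y -> adj (cut y) x (f x).
Proof.
move=> xr yr xy; rewrite /adj /= !inE andbC -[X in X && _]/(adj _ x (f x)) adj_parent //=.
by apply: contra_neq xy; apply: (parent_edge_inj rf); rewrite inE.
Qed.

Lemma connect_cut_side x y : y != r ->
  connect (adj (cut y)) x (if fconnect f x y then y else r).
Proof.
move=> yr; move: x; apply: (rooted_ind rf) => [|x xr IH].
  by rewrite fconnect_root // (negPf yr).
have [->|xy] := eqVneq x y; first by rewrite connect0.
rewrite fconnect_eqVf (negPf xy) /=; apply: connect_trans (connect1 _) IH.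
exact: adj_cut.
Qed.

Lemma connect_cut_child x y : y != r -> connect (adj (cut y)) y x = fconnect f x y.
Proof.
move=> yr; apply/idP/idP => [/(connect_cut_descendant yr)|xy].
  by rewrite connect0 => <-.
by have := connect_cut_side x yr; rewrite xy connect_adjC.
Qed.

Lemma connect_cut_parent x y : y != r -> connect (adj (cut y)) (f y) x = ~~ fconnect f x y.
Proof.
move=> yr; have nfy := negPf (rooted_parent_not_descendant rf yr).
apply/idP/idP => [/(connect_cut_descendant yr) <-|/negPf nxy]; first by rewrite nfy.
have := connect_cut_side x yr; have := connect_cut_side (f y) yr; rewrite nfy nxy => fyr.
by rewrite connect_adjC; exact: connect_trans.
Qed.

End CubicTrees.

Section Decompositions.
Variables (K : fieldType) (V : finType).
Implicit Types (W : V -> V -> K) (U A : {set V}).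

Definition below (T : finType) (f : T -> T) (leaf : V -> T) U (y : T) : {set V} :=
  [set v in U | fconnect f (leaf v) y].

Definition cubic_on U (T : finType) (r : T) (f : T -> T) (leaf : V -> T) : Prop :=
  [/\ rooted r f, {in U &, injective leaf} &
      forall x, parent_deg r f x = if x \in leaf @: U then 1%N else 3%N].

Definition rank_le1_decomposition W U : Prop :=
  exists (T : finType) (r : T) (f : T -> T) (leaf : V -> T), cubic_on U r f leaf /\
    forall y, y != r -> rank_le1 W (below f leaf U y) (U :\: below f leaf U y).

Definition twins W U u v : Prop :=
  [/\ u \in U, v \in U, u != v & rank_le1 W [set u; v] (U :\: [set u; v])].

Definition hereditary_twins W U : Prop :=
  forall A, A \subset U -> (1 < #|A|)%N -> exists u v, twins W A u v.

Lemma small_set_twins W A : (forall i j, W i j = W j i) -> (1 < #|A| <= 3)%N -> exists u v, twins W A u v.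
Proof.
move=> WC /andP [/card_gt1P [u [v [uA vA uv]]] A3]; exists u, v; split=> //.
apply: rank_le1C => //; apply: rank_le1_card.
by rewrite cardsDS ?cards2 ?uv; [lia|apply/subsetP => i /set2P [] ->].
Qed.

(* A highest node with two elements of A below it has at most one below each child. *)
Lemma cubic_below_two U A (T : finType) (r : T) (f : T -> T) (leaf : V -> T) :
  cubic_on U r f leaf -> A \subset U -> (3 < #|A|)%N ->
  exists2 y, y != r & #|below f leaf A y| = 2%N.
Proof.
move=> [rf linj pdeg] /subsetP AU A4; have /rootedP [_ [h hf]] := rf.
have below_root : below f leaf A r = A.
  by apply/setP => v; rewrite inE; case/andP: rf => _ /forallP ->; rewrite andbT.
have [|y y2 ymax] := @arg_maxnP _ r (fun y => 1 < #|below f leaf A y|)%N h.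
  by rewrite below_root; lia.
have child_le1 c : c \in children r f y -> (#|below f leaf A c| <= 1)%N.
  rewrite inE leqNgt => /andP [cr /eqP fc]; apply/negP => /ymax.
  by have := hf c cr; rewrite fc; lia.
have card_below : (#|below f leaf A y| <= (y \in leaf @: U) + #|children r f y|)%N.
  apply: (@leq_trans #|[set v in A | leaf v == y] :|: \bigcup_(c in children r f y) below f leaf A c|).
    apply/subset_leq_card/subsetP => v; rewrite !inE => /andP [vA].
    case/(fconnect_child rf) => [->|[c cy vc]]; first by rewrite vA eqxx.
    by apply/orP; right; apply/bigcupP; exists c; rewrite // inE vA.
  rewrite cardsU; apply: leq_trans (leq_subr _ _) (leq_add _ _).
    have [yU|yU] := boolP (y \in _).
      apply/card_le1_eqP => u v; rewrite !inE => /andP [uA /eqP uy] /andP [vA /eqP vy].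
      by apply: linj; rewrite ?AU // uy.
    rewrite leqn0 cards_eq0; apply/eqP/setP => v; rewrite !inE.
    by apply: contraNF yU => /andP [/AU vU /eqP <-]; apply: imset_f.
  rewrite -[leqRHS]sum1_card; elim/big_rec2: _ => [|c n B cy Bn]; first by rewrite cards0.
  by rewrite cardsU; apply: leq_trans (leq_subr _ _) (leq_add (child_le1 c cy) Bn).
move: (pdeg y) card_below; rewrite /parent_deg => degy card_below.
have yr : y != r.
  apply: contraTneq A4 => yr; move: degy card_below; rewrite yr below_root eqxx addn0 -leqNgt.
  by case: ifP => _; lia.
by exists y => //; move: degy card_below y2; rewrite yr; case: ifP => _; lia.
Qed.

Lemma rank_le1_decomposition_hereditary_twins W U : (forall i j, W i j = W j i) ->
  rank_le1_decomposition W U -> hereditary_twins W U.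
Proof.
move=> WC [T [r [f [leaf [cub cuts]]]]] A AU A2.
have [A4|A3] := ltnP 3 #|A|; last by apply: small_set_twins; rewrite ?A2.
have [y yr /eqP/cards2P [u [v [uv belowE]]]] := cubic_below_two cub AU A4.
have belowP i : i \in [set u; v] = (i \in A) && fconnect f (leaf i) y by rewrite -belowE inE.
have /andP [uA _] : (u \in A) && fconnect f (leaf u) y by rewrite -belowP set21.
have /andP [vA _] : (v \in A) && fconnect f (leaf v) y by rewrite -belowP set22.
exists u, v; split=> //; apply: rank_le1S (cuts y yr).
  by apply/subsetP => i; rewrite belowP inE => /andP [/(subsetP AU) ->].
apply/subsetP => i; rewrite in_setD belowP in_setD inE => /andP [+ iA].
by rewrite iA (subsetP AU) // andbT.
Qed.

End Decompositions.

Section Proportional.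
Variables (K : numFieldType) (V : finType).
Implicit Types (W : V -> V -> K) (U : {set V}) (u v : V) (c : K).

Definition proportional W U u v c : Prop :=
  [/\ u \in U, v \in U, u != v, 0 <= c & forall k, k \in U :\: [set u; v] -> W u k = c * W v k].

Lemma twins_proportional W U u v : (forall i j, 0 <= W i j) -> twins W U u v ->
  exists u' v' c, proportional W U u' v' c.
Proof.
move=> W_ge0 [uU vU uv rk].
have [/exists_inP [l lU vl]|] := boolP [exists l in U :\: [set u; v], W v l != 0].
  exists u, v, (W u l / W v l); split; rewrite ?divr_ge0 // => k kU.
  by rewrite mulrAC (rk u v l k) ?set21 ?set22 // mulfK.
rewrite negb_exists_in => /forall_inP v0.
exists v, u, 0; split; rewrite 1?eq_sym 1?setUC // => k /v0; rewrite negbK mul0r.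
by move/eqP.
Qed.

End Proportional.

Section WidthOne.
Variables (R : realType) (V : finType) (E : {set {set V}}) (w : {set V} -> R).

Lemma cut_rank_le1P (A : {set V}) :
  (cut_rank E w A <= 1)%N <-> rank_le1 (wadj E w) (~: A) A.
Proof.
rewrite /cut_rank mxrank_le1P; split=> [minors0 i i' k k' iA i'A kA k'A|rk i i' k k'].
  have := minors0 (enum_rank_in iA i) (enum_rank_in i'A i') (enum_rank_in kA k) (enum_rank_in k'A k').
  by rewrite !mxE /= !enum_rankK !enum_rankK_in.
by rewrite !mxE /= !enum_rankK; apply: rk; exact: enum_valP.
Qed.

Lemma tree_width_le1P (T : leaf_tree V) (r : node T) (f : node T -> node T) :
  rooted r f -> tree_edges T = parent_edges r f ->
  (tree_width E w T <= 1)%N <-> forall y, y != r ->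
    rank_le1 (wadj E w) (below f (leaf T) setT y) (~: below f (leaf T) setT y).
Proof.
move=> rf TE; pose B y := below f (leaf T) setT y.
have side_child y : y != r -> side [set y; f y] y = B y.
  by move=> yr; apply/setP => v; rewrite !inE TE connect_cut_child.
have side_parent y : y != r -> side [set y; f y] (f y) = ~: B y.
  by move=> yr; apply/setP => v; rewrite !inE TE connect_cut_parent.
split=> [/bigmax_leqP width1 y yr|cuts].
  apply: rank_le1C; first exact: wadjC.
  apply/cut_rank_le1P; rewrite -/(B y) -side_child //.
  have /width1/bigmax_leqP : [set y; f y] \in tree_edges T.
    by rewrite TE; apply/parent_edgesP; exists y.
  by apply; rewrite set21.
apply/bigmax_leqP => e; rewrite TE => /parent_edgesP [y yr ->].
apply/bigmax_leqP => a /set2P [] ->; apply/cut_rank_le1P.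
  by rewrite side_child //; apply: rank_le1C; [exact: wadjC|exact: cuts].
by rewrite side_parent // setCK; exact: cuts.
Qed.

Lemma leaf_tree_cubic (T : leaf_tree V) (r : node T) (f : node T -> node T) :
  rooted r f -> tree_edges T = parent_edges r f -> cubic_on setT r f (leaf T).
Proof.
move=> rf TE; split=> // [u v _ _|x]; first exact: leaf_inj.
rewrite -deg_parent_edges // -TE; case: ifPn => [/imsetP [v _ ->]|xleaf].
  by apply/leafP; exists v.
by apply: innerP => /leafP [v xv]; rewrite xv imset_f in xleaf.
Qed.

Lemma width_le1P : (0 < #|V|)%N ->
  (exists T : leaf_tree V, (tree_width E w T <= 1)%N) <-> rank_le1_decomposition (wadj E w) setT.
Proof.
move=> /card_gt0P [v0 _]; split=> [[T widthT]|[T [r [f [leaf [cub cuts]]]]]].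
  have [f rf TE] := tree_parent_edges (leaf T v0) (tree_edgesP T).
  exists (node T), (leaf T v0), f, (leaf T); split; first exact: leaf_tree_cubic.
  by move=> y yr; rewrite setTD; apply: (iffLR (tree_width_le1P rf TE)).
have [rf linj pdeg] := cub.
have leaf_inj : injective leaf by move=> u v; apply: linj.
have leafP x : deg (parent_edges r f) x = 1%N <-> exists v, x = leaf v.
  rewrite deg_parent_edges // pdeg; case: imsetP => [[v _ ->]|nleaf].
    by split=> // _; exists v.
  by split=> // [[v xv]]; case: nleaf; exists v.
have innerP x : deg (parent_edges r f) x <> 1%N -> deg (parent_edges r f) x = 3%N.
  by rewrite deg_parent_edges // pdeg; case: ifP.
exists (LeafTree (parent_edges_tree rf) leaf_inj leafP innerP).
apply: (iffRL (tree_width_le1P (T := LeafTree _ _ _ _) rf (erefl _))) => y yr.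
by have := cuts y yr; rewrite setTD.
Qed.

End WidthOne.

(** * Twins imply rigidity *)

Section WeightConnectivity.
Variables (K : nzRingType) (V : finType).
Implicit Types (W : V -> V -> K) (U : {set V}) (u v : V).

Definition weight_connected W U : Prop := forall g : V -> bool,
  {in U &, forall i j, W i j != 0 -> g i = g j} -> {in U &, forall i j, g i = g j}.

Lemma weight_connected_neighbour W U u v : (forall i j, W i j = W j i) -> weight_connected W U ->
  u \in U -> v \in U -> u != v -> exists2 j, j \in U :\ u & W u j != 0.
Proof.
move=> WC connU uU vU uv; apply/exists_inP; apply: contraT.
rewrite negb_exists_in => /forall_inP isolated.
have no_edge j : j \in U -> W u j != 0 -> j = u.
  by move=> jU uj; apply/eqP; apply: contraNT uj => ju; rewrite -[_ == _]negbK isolated // !inE ju.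
suff : (u == u) = (v == u) by rewrite eqxx eq_sym (negPf uv).
apply: (connU (pred1 u)) => //= i j iU jU ij.
have [iu|iu] := eqVneq i u; first by rewrite (no_edge j) ?eqxx // -iu.
have [ju|//] := eqVneq j u.
by case/eqP: iu; apply: no_edge => //; rewrite -ju WC.
Qed.

End WeightConnectivity.

Lemma connected_weight_connected (R : numDomainType) (V : finType)
    (E : {set {set V}}) (w : {set V} -> R) :
  connected_graph E -> (forall e, e \in E -> 0 < w e) -> weight_connected (wadj E w) setT.
Proof.
move=> cE w0 g gconst i j _ _.
apply: (@closed_connect _ (adj E) g) (cE i j) => a b ab.
by apply: gconst; rewrite ?inE // /wadj (ab : [set a; b] \in E) gt_eqF ?w0.
Qed.

Section TwinRigidity.
Variables (R : rcfType) (V : finType) (W : V -> V -> R).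
Hypotheses (WC : forall i j, W i j = W j i) (W_ge0 : forall i j, 0 <= W i j).
Implicit Types (U A : {set V}) (x z : V -> R[i]) (u v : V) (c : R).

Section ProportionalPair.
Variables (U : {set V}) (u v : V) (c : R).
Hypotheses (prop_uv : proportional W U u v c) (connU : weight_connected W U).

Lemma weight_connectedD1 : weight_connected W (U :\ u).
Proof.
case: prop_uv => uU vU uv _ prop g gconst.
pose g' k := if k == u then g v else g k.
have g'E k : k != u -> g' k = g k by rewrite /g' => /negPf ->.
have vU' : v \in U :\ u by rewrite !inE eq_sym uv.
have g'u j : j \in U -> W u j != 0 -> g v = g' j.
  move=> jU uj; rewrite /g'; case: eqVneq => // ju.
  have [->//|jv] := eqVneq j v; apply: gconst => //; first by rewrite !inE ju.
  by apply: contraNneq uj => vj; rewrite prop ?vj ?mulr0 // !inE negb_or ju jv.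
move=> i j; rewrite !inE => /andP [iu iU] /andP [ju jU].
rewrite -(g'E i) // -(g'E j) //; apply: connU => // {i j iu iU ju jU} i j iU jU ij.
have [iu|iu] := eqVneq i u; first by rewrite {1}/g' iu eqxx; apply: g'u; rewrite // -iu.
have [ju|ju] := eqVneq j u.
  by rewrite [RHS]/g' ju eqxx; apply/esym/g'u; rewrite // -ju WC.
by rewrite !g'E //; apply: gconst; rewrite // !inE ?iu ?ju.
Qed.

Let B := U :\: [set u; v].

Lemma sum_setD2 (F : V -> R[i]) : \sum_(j in U) F j = F u + F v + \sum_(j in B) F j.
Proof.
case: prop_uv => uU vU uv _ _.
rewrite (big_setD1 u) // (big_setD1 v) /=; last by rewrite !inE eq_sym uv.
by rewrite setDDl addrA.
Qed.

Variables (x z : V -> R[i]).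
Hypotheses (ux : {in U, forall i, upper (x i)}) (bal : balanced W U x z).

Lemma upper_proportional_sum :
  upper ((c * W u v)%:C * x u + (W u v)%:C * x v + c%:C * \sum_(j in B) (W v j)%:C * x j).
Proof.
case: prop_uv => uU vU uv c_ge0 prop; pose a j := if j == u then c * W u v else W u j.
have aE j : j != u -> a j = W u j by rewrite /a => /negPf ->.
have <- : \sum_(j in U) (a j)%:C * x j =
    (c * W u v)%:C * x u + (W u v)%:C * x v + c%:C * \sum_(j in B) (W v j)%:C * x j.
  rewrite sum_setD2 (aE v) 1?eq_sym // {1}/a eqxx mulr_sumr; congr (_ + _).
  apply: eq_bigr => j jB; rewrite aE; first by rewrite prop // rmorphM -mulrA.
  by move: jB; rewrite !inE negb_or => /andP [/andP []].
have [j /setD1P [ju jU] uj] := weight_connected_neighbour WC connU uU vU uv.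
apply: (@upper_wsum _ _ _ _ _ j) => // [|i iU]; first by rewrite aE // lt_neqAle eq_sym uj W_ge0.
by rewrite /a; case: ifP => _ //; exact: mulr_ge0.
Qed.

Lemma proportional_value : z u = z v.
Proof.
case: prop_uv => uU vU uv c_ge0 prop; have upperP := upper_proportional_sum.
have /balancedP balE := bal; have := balE u uU; have := balE v vU.
rewrite !sum_setD2; move: upperP.
set Q := \sum_(j in B) (W v j)%:C * (x j * z j); set S := \sum_(j in B) (W v j)%:C * x j.
have -> : \sum_(j in B) (W u j)%:C * (x j * z j) = c%:C * Q.
  by rewrite mulr_sumr; apply: eq_bigr => j jB; rewrite prop // rmorphM -mulrA.
have -> : \sum_(j in B) (W u j)%:C * x j = c%:C * S.
  by rewrite mulr_sumr; apply: eq_bigr => j jB; rewrite prop // rmorphM -mulrA.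
move=> upperP bal_v bal_u.
apply/eqP; rewrite -subr_eq0; apply/eqP; apply: (mulfI (upper_neq0 upperP)); rewrite mulr0.
transitivity (c%:C * ((W v u)%:C * (x u * z u) + (W v v)%:C * (x v * z v) + Q)
              - ((W u u)%:C * (x u * z u) + (W u v)%:C * (x v * z v) + c%:C * Q)
              - (c%:C * (((W v u)%:C * x u + (W v v)%:C * x v + S) * z v)
                 - ((W u u)%:C * x u + (W u v)%:C * x v + c%:C * S) * z u)).
  by rewrite (WC v u) rmorphM; ring.
by rewrite bal_v bal_u subrr.
Qed.

Definition absorb (i : V) : R[i] := if i == v then x v + c%:C * x u else x i.

Lemma upper_absorb : {in U :\ u, forall i, upper (absorb i)}.
Proof.
case: prop_uv => uU vU _ c_ge0 _ i; rewrite /absorb !inE => /andP [_ iU].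
case: ifP => _; last exact: ux.
rewrite /upper ImD ImMr; apply: ltr_wpDr; last exact: ux.
by rewrite mulr_ge0 // ltW //; exact: ux.
Qed.

Lemma balanced_absorb : balanced W (U :\ u) absorb z.
Proof.
case: prop_uv => uU vU uv _ prop i /setD1P [iu iU].
have vU' : v \in U :\ u by rewrite !inE eq_sym uv.
rewrite -[RHS](bal iU) sum_setD2 (big_setD1 v) //= setDDl; congr (_ + _); last first.
  by apply: eq_bigr => j; rewrite /absorb !inE negb_or => /andP [/andP [_ /negPf ->]].
rewrite /absorb eqxx proportional_value; have [->|iv] := eqVneq i v; first by ring.
have -> : W i u = c * W i v by rewrite !(WC i) prop // !inE negb_or iu iv.
by rewrite rmorphM; ring.
Qed.

End ProportionalPair.

Lemma hereditary_twins_rigid U : hereditary_twins W U -> weight_connected W U -> rigid W U.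
Proof.
have [n] := ubnP #|U|; elim: n U => // n IH U Un twinsU connU x z ux bal.
have [/card_le1_eqP U1|U2] := leqP #|U| 1; first by move=> i j iU jU; rewrite (U1 i j).
have [u0 [v0 /(twins_proportional W_ge0) [u [v [c prop]]]]] := twinsU U (subxx U) U2.
have [uU vU uv _ _] := prop.
have zD1 : {in U :\ u &, forall i j, z i = z j}.
  apply: (IH _ _ _ _ (absorb u v c x)).
  - by move: Un; rewrite (cardsD1 u) uU.
  - by move=> A /subset_trans /(_ (subsetDl _ _)); exact: twinsU.
  - exact: weight_connectedD1 prop connU.
  - exact: (upper_absorb prop ux).
  - exact: (balanced_absorb prop connU ux bal).
have zv i : i \in U -> z i = z v.
  move=> iU; have [->|iu] := eqVneq i u; first exact: (proportional_value prop connU ux bal).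
  by apply: zD1; rewrite !inE ?iu // eq_sym uv.
by move=> i j iU jU; rewrite !zv.
Qed.

End TwinRigidity.

(** * The resolvent *)

Lemma findet_diag_dominant_neq0 (K : realFieldType) (V : finType) (b : V -> V -> K) :
  (forall i, \sum_(j | j != i) `|b i j| < `|b i i|) -> findet b != 0.
Proof.
move=> dom; apply/findet0P => -[y [v yv] by0].
case: (@arg_maxP _ _ _ v predT (fun i => `|y i|) isT) => i _ imax.
have yi : 0 < `|y i| by apply: lt_le_trans (imax v isT); rewrite normr_gt0.
have := dom i; apply/negP; rewrite -leNgt -(ler_pM2r yi) -normrM.
have /eqP := by0 i; rewrite (bigD1 i) //= addr_eq0 => /eqP ->.
rewrite normrN mulr_suml; apply: le_trans (ler_norm_sum _ _ _) _.
by apply: ler_sum => j _; rewrite normrM ler_wpM2l //; exact: imax.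
Qed.

Section Resolvent.
Variables (R : realFieldType) (V : finType) (W : V -> V -> R).
Hypotheses (WC : forall i j, W i j = W j i) (W_ge0 : forall i j, 0 <= W i j).
Implicit Types (A : {set V}) (i j k : V).

Definition shift : R := 1 + \sum_i \sum_j W i j.

Definition shifted i j : R := shift * (i == j)%:R - W i j.

Definition resolvent : V -> V -> R := fininv shifted.

Lemma row_sum_lt_shift i : \sum_j W i j < shift.
Proof.
rewrite /shift [X in 1 + X](bigD1 i) //= addrCA ltrDl ltr_wpDr //.
by apply: sumr_ge0 => k _; apply: sumr_ge0.
Qed.

Lemma sum_shifted (y : V -> R) i : \sum_j shifted i j * y j = shift * y i - \sum_j W i j * y j.
Proof.
under eq_bigr do rewrite mulrBl -mulrA.
by rewrite sumrB -mulr_sumr sum_mul_delta.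
Qed.

Lemma findet_shifted_neq0 : findet shifted != 0.
Proof.
apply: findet_diag_dominant_neq0 => i; have := row_sum_lt_shift i.
rewrite (bigD1 i) //= -ltrBrDl => rest; rewrite {2}/shifted eqxx mulr1.
have -> : \sum_(j | j != i) `|shifted i j| = \sum_(j | j != i) W i j.
  by apply: eq_bigr => j ji; rewrite /shifted eq_sym (negPf ji) mulr0 sub0r normrN ger0_norm.
apply: lt_le_trans rest (ler_norm _).
Qed.

Lemma resolventC i j : resolvent i j = resolvent j i.
Proof. by apply: fininvC => k l; rewrite /shifted WC eq_sym. Qed.

Lemma mul_resolvent i j : \sum_k W i k * resolvent k j = shift * resolvent i j - (i == j)%:R.
Proof. by rewrite /resolvent -(mul_fininv i j findet_shifted_neq0) sum_shifted; ring. Qed.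

Lemma resolvent_ge0 i j : 0 <= resolvent i j.
Proof.
case: (@arg_minP _ _ _ i predT (fun k => resolvent k j) isT) => k _ kmin.
apply: le_trans (kmin i isT).
have : 0 <= (shift - \sum_l W k l) * resolvent k j.
  apply: (@le_trans _ _ (k == j)%:R); first exact: ler0n.
  rewrite -(mul_fininv k j findet_shifted_neq0) sum_shifted mulrBl lerB // mulr_suml.
  by apply: ler_sum => l _; rewrite ler_wpM2l //; exact: kmin.
by rewrite pmulr_rge0 // subr_gt0 row_sum_lt_shift.
Qed.

Lemma resolvent_gt0 i j : weight_connected W setT -> 0 < resolvent i j.
Proof.
move=> connW; rewrite lt_neqAle resolvent_ge0 andbT eq_sym.
have zero k : resolvent k j = 0 -> k != j /\ forall l, W k l != 0 -> resolvent l j = 0.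
  move=> Nkj; have := mul_resolvent k j; rewrite Nkj mulr0 sub0r => sumE.
  have terms_ge0 l : true -> 0 <= W k l * resolvent l j by rewrite mulr_ge0 ?resolvent_ge0.
  have sum0 : \sum_l W k l * resolvent l j = 0.
    by apply/eqP; rewrite eq_le sumr_ge0 // sumE oppr_le0 ler0n.
  split=> [|l Wkl]; last first.
    by have /eqP := psumr_eq0P terms_ge0 sum0 (i := l) isT; rewrite mulf_eq0 (negPf Wkl) => /eqP.
  by move/eqP: sumE; rewrite sum0 eq_sym oppr_eq0 pnatr_eq0 eqb0.
have nonzero k l : W k l != 0 -> (resolvent k j != 0) = (resolvent l j != 0).
  move=> Wkl; congr (~~ _); apply/eqP/eqP => [/zero [_]|/zero [_]]; first exact.
  by apply; rewrite WC.
rewrite (connW (fun k => resolvent k j != 0) _ i j) ?inE // => [|k l _ _]; last exact: nonzero.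
by apply/eqP => /zero []; rewrite eqxx.
Qed.

Lemma rank_le1_resolvent A : rank_le1 resolvent A (~: A) -> rank_le1 W A (~: A).
Proof.
move/(rank_le1_fininv A findet_shifted_neq0) => rk i i' k k' iA i'A kA k'A.
have offdiag j l : j \in A -> l \in ~: A -> W j l = - shifted j l.
  move=> jA; rewrite in_setC => lA; rewrite /shifted.
  by have [jl|_] := eqVneq j l; [rewrite -jl jA in lA|rewrite mulr0 sub0r opprK].
by rewrite !offdiag // !mulrNN rk.
Qed.

End Resolvent.

Lemma rigid_resolvent (R : rcfType) (V : finType) (W : V -> V -> R) :
  (forall i j, W i j = W j i) -> (forall i j, 0 <= W i j) ->
  weight_connected W setT -> rigid W setT -> rigid (resolvent W) setT.
Proof.
move=> WC W_ge0 connW rig x z ux /balancedP bal.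
pose N_ (s : V -> R[i]) i := \sum_j (resolvent W i j)%:C * s j.
have mulWN s i : \sum_j (W i j)%:C * N_ s j = (shift W)%:C * N_ s i - s i.
  under eq_bigr do rewrite mulr_sumr.
  rewrite exchange_big -[s i](sum_mul_delta i) mulr_sumr -sumrB; apply: eq_bigr => k _ /=.
  under eq_bigr do rewrite mulrA -rmorphM.
  by rewrite -mulr_suml -rmorph_sum (mul_resolvent W_ge0) rmorphB rmorphM rmorph_nat /=; ring.
have N_xz i : N_ (fun j => x j * z j) i = N_ x i * z i.
  by have := bal i (in_setT i); rewrite !sum_setT.
apply: (rig (N_ x)) => [i _|].
  apply: (@upper_wsum _ _ _ _ _ i) => // [|j _|j _]; last exact: ux.
    exact: resolvent_gt0.
  exact: resolvent_ge0.
apply/balancedP => i _; rewrite !sum_setT.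
under eq_bigr do rewrite -N_xz.
by rewrite !mulWN N_xz; ring.
Qed.

(** * Rigidity passes to subsets *)

Section PolynomialLimits.
Variable C : numClosedFieldType.

Lemma ler_horner_no_small_root (p : {poly C}) (rho u : C) : 0 < rho ->
  (forall t, root p t -> rho <= `|t|) ->
  `|p.[u]| <= `|p.[0]| * (1 + `|u| / rho) ^+ size p.
Proof.
move=> rho0 noroot.
have [->|pn0] := eqVneq p 0; first by rewrite !horner0 normr0 mul0r.
have [s ps] := closed_field_poly_normal p.
have rootE t : root p t = (t \in s).
  by rewrite ps rootZ ?lead_coef_eq0 // root_prod_XsubC.
have hornE t : `|p.[t]| = `|lead_coef p| * \prod_(a <- s) `|t - a|.
  rewrite {1}ps hornerZ normrM horner_prod normr_prod; congr (_ * _).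
  by apply: eq_bigr => a _; rewrite hornerXsubC.
have size_s : (size s <= size p)%N.
  by rewrite ps size_scale ?lead_coef_eq0 // size_prod_XsubC.
have c1 : 1 <= 1 + `|u| / rho by rewrite lerDl divr_ge0 // ltW.
apply: (@le_trans _ _ (`|p.[0]| * (1 + `|u| / rho) ^+ size s)); last first.
  by rewrite ler_wpM2l // ler_weXn2l.
rewrite !hornE -mulrA ler_wpM2l //.
have -> : (1 + `|u| / rho) ^+ size s = \prod_(a <- s) (1 + `|u| / rho).
  by rewrite big_const_seq count_predT iter_mulr_1.
rewrite -big_split !big_seq; apply: ler_prod => a sa /=; rewrite normr_ge0 /=.
have rho_a : rho <= `|a| by apply: noroot; rewrite rootE.
apply: le_trans (ler_normB _ _) _.
rewrite sub0r normrN mulrDr mulr1 addrC lerD2l mulrCA ler_peMr //.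
by rewrite ler_pdivlMr // mul1r.
Qed.

Lemma horner0_limit (p q : {poly C}) (B : C) : 0 <= B -> q.[0] = 0 ->
  (forall e, 0 < e -> `|p.[e]| <= B * `|q.[e]|) -> p.[0] = 0.
Proof.
move=> B0 q0 le_pq.
have [p1 pE] : exists p1, p = p1 * 'X + p.[0]%:P.
  have /factor_theorem [p1 p1E] : root (p - p.[0]%:P) 0.
    by rewrite /root hornerD hornerN hornerC subrr.
  by exists p1; rewrite -['X]subr0 -p1E subrK.
have [q1 qE] : exists q1, q = q1 * 'X.
  by have /factor_theorem [q1 q1E] : root q 0; [exact/eqP|exists q1; rewrite -['X]subr0].
have [M p1M] := poly_disk_bound p1 1; have [M' q1M] := poly_disk_bound q1 1.
have M_ge0 : 0 <= B * M' + M.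
  by rewrite addr_ge0 ?mulr_ge0 //; [move: (q1M 0)|move: (p1M 0)];
    rewrite normr0 ler01 => /(_ isT); apply: le_trans; exact: normr_ge0.
have le_p0 e : 0 < e -> e <= 1 -> `|p.[0]| <= e * (B * M' + M).
  move=> e0 e1; have en : `|e| = e by rewrite gtr0_norm.
  have -> : p.[0] = p.[e] - p1.[e] * e by rewrite {2}pE hornerMXaddC addrC addKr.
  apply: le_trans (ler_normB _ _) _; rewrite normrM en mulrDr; apply: lerD; last first.
    by rewrite mulrC ler_wpM2l ?p1M ?en // ltW.
  apply: le_trans (le_pq e e0) _; rewrite qE hornerMX normrM en mulrA mulrC.
  by rewrite !ler_wpM2l ?q1M ?en // ltW.
apply/eqP; rewrite -normr_eq0; apply: contraT => p0.
have p_gt0 : 0 < `|p.[0]| by rewrite lt_def p0 normr_ge0.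
have sum_gt0 : 0 < B * M' + M + `|p.[0]| by exact: ltr_wpDl.
have := le_p0 (`|p.[0]| / (B * M' + M + `|p.[0]|)).
rewrite divr_gt0 // ler_pdivrMr // mul1r lerDr M_ge0 => /(_ isT isT).
by rewrite mulrAC ler_pdivlMr // ler_pM2l // gerDl (lt_geF p_gt0).
Qed.

(* If F.[_].[0] did not vanish identically, roots of F.[_].[e] would tend to its root 0 as e -> 0+. *)
Lemma hurwitz (F : {poly {poly C}}) (rho u : C) : 0 < rho ->
  (forall e t, 0 < e -> F.[t%:P].[e] = 0 -> rho <= `|t|) ->
  F.[0].[0] = 0 -> F.[u%:P].[0] = 0.
Proof.
move=> rho0 noroot F00; pose Fe e := map_poly (horner_eval e) F.
have FE e t : F.[t%:P].[e] = (Fe e).[t].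
  have {2}-> : t = horner_eval e t%:P by rewrite /horner_eval hornerC.
  by rewrite horner_map.
have c1 : 1 <= 1 + `|u| / rho by rewrite lerDl divr_ge0 // ltW.
apply: (horner0_limit (q := F.[0]) (B := (1 + `|u| / rho) ^+ size F)) => // [|e e0].
  by rewrite exprn_ge0 // (le_trans ler01 c1).
rewrite -polyC0 !FE mulrC.
apply: le_trans (ler_horner_no_small_root u rho0 _) _ => [t /eqP Fet|].
  by apply: (noroot e); rewrite // FE.
by rewrite ler_wpM2l // ler_weXn2l // size_poly.
Qed.

End PolynomialLimits.

Lemma upper_ball (R : rcfType) (y t : R[i]) : `|t| < (complex.Im y)%:C -> upper (y + t).
Proof.
move=> ty; rewrite /upper ImD -ltrBlDl sub0r ltrNl -ltcR; apply: le_lt_trans ty.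
rewrite normc_def lecR; apply: le_trans (ler_norm _) _.
by rewrite normrN -sqrtr_sqr ler_wsqrtr // lerDr sqr_ge0.
Qed.

Lemma upper_perturbation (R : rcfType) (I : finType) (P : pred I) (x c : I -> R[i]) :
  (forall i, P i -> upper (x i)) ->
  exists2 rho : R[i], 0 < rho & forall (t : R[i]) i, `|t| < rho -> P i -> upper (x i + t * c i).
Proof.
move=> ux; pose c1 i := 1 + complex.Re `|c i|.
have c1E i : (c1 i)%:C = 1 + `|c i| by rewrite rmorphD rmorph1.
have c1_gt0 i : 0 < c1 i by rewrite ltr_pwDl // -ler0c RRe_real ?normr_real.
pose rho := \big[Num.min/1]_(i | P i) (complex.Im (x i) / c1 i).
exists rho%:C => [|t i t_lt Pi].
  by rewrite ltcR; apply/bigmin_gtP; split=> // i Pi; rewrite divr_gt0 // -/(upper _) ux.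
apply: upper_ball; rewrite normrM.
have rho_le : rho%:C <= (complex.Im (x i))%:C / (1 + `|c i|).
  by rewrite -c1E -fmorphV -rmorphM lecR bigmin_le_cond.
apply: (@le_lt_trans _ _ (`|t| * (1 + `|c i|))); first by rewrite ler_wpM2l // lerDr.
by rewrite -ltr_pdivlMr ?(lt_le_trans t_lt) // -c1E ltcR.
Qed.

Section Heredity.
Variables (R : rcfType) (V : finType) (N : V -> V -> R).
Hypotheses (NC : forall i j, N i j = N j i) (N_gt0 : forall i j, 0 < N i j).
Implicit Types (U : {set V}) (x y z : V -> R[i]).

(* Off U the solution is extended by weighted averages. *)
Lemma laplacian_det_extension_eq0 U x z (r s : V) : r \in U -> s \in U -> z s != z r ->
  {in U, forall i, upper (x i)} -> balanced N U x z ->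
  laplacian_det N r (fun j => if j \in U then x j else 0) = 0.
Proof.
move=> rU sU zsr ux bal; apply/eqP/rooted_laplacian0P.
pose S i := \sum_(j in U) (N i j)%:C * x j.
have S_neq0 i : S i != 0.
  by apply/upper_neq0/(@upper_wsum _ _ _ _ _ r) => // j _; exact: ltW.
pose z' i := if i \in U then z i else (\sum_(j in U) (N i j)%:C * x j * z j) / S i.
exists z'; first by exists s; rewrite /z' rU sU.
move=> i _; transitivity (\sum_(j in U) (N i j)%:C * x j * (z j - z' i)).
  rewrite [RHS]big_mkcond; apply: eq_bigr => j _.
  by rewrite {1}/z'; case: ifP => _; rewrite ?mulr0 ?mul0r.
have [iU|iU] := boolP (i \in U); first by rewrite /z' iU bal.
under eq_bigr do rewrite mulrBr.
by rewrite sumrB -mulr_suml -/(S i) /z' (negPf iU) mulrC divfK // subrr.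
Qed.

Lemma laplacian_det_indicator_neq0 U (r : V) :
  r \in U -> laplacian_det N r (fun j => (j \in U)%:R) != 0.
Proof.
move=> rU; rewrite /laplacian_det findet_rooted_laplacian gt_eqF //.
have c_ge0 i j : 0 <= (N i j)%:C * (j \in U)%:R by rewrite mulr_ge0 ?ler0n // ler0c ltW.
have rooted_const : rooted r [ffun=> r].
  apply/rootedP; rewrite ffunE; split=> //; exists (fun i => i != r : nat) => i ir.
  by rewrite ffunE eqxx ir.
rewrite (bigD1 [ffun=> r]) //= ltr_wpDr //; first by apply: sumr_ge0 => f _; apply: prodr_ge0.
by apply: prodr_gt0 => i _; rewrite ffunE rU mulr1 ltcR.
Qed.

Lemma laplacian_det_poly U x y (r : V) : exists F : {poly {poly R[i]}}, forall t e,
  F.[t%:P].[e] = laplacian_det N r (fun j => if j \in U then x j + t * (y j - x j) else 'i * e).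
Proof.
pose X j : {poly {poly R[i]}} :=
  if j \in U then (x j)%:P%:P + 'X * (y j - x j)%:P%:P else ('i *: 'X)%:P.
exists (findet (rooted_laplacian r (fun i j => (N i j)%:C%:P%:P * X j))) => t e.
rewrite -[_.[t%:P]]/(horner_eval t%:P _) -[_.[e]]/(horner_eval e _) !findet_map.
apply: eq_findet => i j; rewrite !rooted_laplacian_map; apply: eq_rooted_laplacian => {}i {}j.
by rewrite /= /horner_eval /X; case: ifP => _; rewrite !hornerE.
Qed.

Lemma rigid_subset U : rigid N setT -> rigid N U.
Proof.
move=> rig x z ux bal s r sU rU; apply/eqP; apply: contraT => zsr.
have det0 := laplacian_det_extension_eq0 rU sU zsr ux bal.
have [F FE] := laplacian_det_poly U x (fun=> 1) r.
have [rho rho0 upper_near] := upper_perturbation (fun j => 1 - x j) ux.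
suff : F.[1%:P].[0] = 0.
  rewrite FE => F10; have /eqP [] := laplacian_det_indicator_neq0 rU; rewrite -[RHS]F10.
  apply/eq_findet/eq_rooted_laplacian => i j; congr (_ * _).
  by case: ifP => _; rewrite ?mulr0 // mul1r addrC subrK.
apply: (hurwitz (rho := rho)) => // [e t e0 Fte|].
  have : laplacian_det N r (fun j => if j \in U then x j + t * (1 - x j) else 'i * e) == 0.
    by rewrite -FE Fte.
  apply: contraTT; rewrite -real_ltNge ?normr_real ?gtr0_real // => t_rho.
  apply: (iffLR (rigid_setTP r NC)) => // j; case: ifP => [jU|_]; first exact: upper_near.
  by move: e0; case: e {Fte} => a b; rewrite /upper /= ltcE /= mul0r add0r mul1r => /andP [].
rewrite -polyC0 FE -[RHS]det0.
apply/eq_findet/eq_rooted_laplacian => i j; congr (_ * _).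
by case: ifP => _; rewrite ?mulr0 // mul0r addr0.
Qed.

End Heredity.

(** * The four-point condition *)

Section Rescaling.
Variables (K : fieldType) (V : finType).
Implicit Types (N : V -> V -> K) (d : V -> K) (A B : {set V}) (i j k l q : V).

Definition four_point N i j k l : bool :=
  [|| N i j * N k l == N i k * N j l, N i k * N j l == N i l * N j k |
      N i l * N j k == N i j * N k l].

Definition rescale d N i j : K := d i * d j * N i j.

Definition pivot q N i : K := if i == q then 1 else (N i q)^-1.

Definition normalized q N : V -> V -> K := rescale (pivot q N) N.

Lemma rescaleC d N i j : (forall i j, N i j = N j i) -> rescale d N i j = rescale d N j i.
Proof. by move=> NC; rewrite /rescale NC (mulrC (d i)). Qed.

Lemma four_point_rescale d N i j k l :
  (forall i, d i != 0) -> four_point (rescale d N) i j k l = four_point N i j k l.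
Proof.
move=> d_neq0; pose D := d i * d j * d k * d l.
have eqD x y x' y' : x' = D * x -> y' = D * y -> (x' == y') = (x == y).
  by move=> -> ->; rewrite (inj_eq (mulfI _)) // !mulf_neq0.
by congr (_ || (_ || _)); apply: eqD; rewrite /rescale /D; ring.
Qed.

Lemma four_point_not_uniq N i j k l :
  (forall i j, N i j = N j i) -> ~~ uniq [:: i; j; k; l] -> four_point N i j k l.
Proof.
move=> NC; rewrite /= !inE !negb_and !negbK orbF -!orbA /four_point.
case/or4P=> [/eqP->|/eqP->|/eqP->|/or3P [] /eqP->].
- by rewrite [N j l * _]mulrC eqxx orbT.
- by rewrite [N k l * _]mulrC (NC j k) eqxx !orbT.
- by rewrite [N l j * _]mulrC (NC l k) (NC l j) eqxx.
- by rewrite eqxx.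
- by rewrite (NC l k) eqxx !orbT.
- by rewrite eqxx orbT.
Qed.

Lemma rank_le1_rescale d N A B :
  (forall i, d i != 0) -> rank_le1 (rescale d N) A B -> rank_le1 N A B.
Proof.
move=> d_neq0; apply: (rank_le1_pullback (phi := id) (g := fun i => (d i)^-1) (h := fun i => (d i)^-1)) => //.
by move=> i k _ _; rewrite /rescale -invfM mulKf // mulf_neq0.
Qed.

Lemma normalized1 q N i : N i q != 0 -> i != q -> normalized q N i q = 1.
Proof. by move=> Niq /negPf iq; rewrite /normalized /rescale /pivot iq eqxx mulr1 mulVf. Qed.

End Rescaling.

Lemma pivot_gt0 (K : numFieldType) (V : finType) (N : V -> V -> K) (q i : V) :
  (forall i j, 0 < N i j) -> 0 < pivot q N i.
Proof. by move=> N_gt0; rewrite /pivot; case: ifP; rewrite ?invr_gt0. Qed.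

Lemma rigid_rescale (R : rcfType) (V : finType) (W : V -> V -> R) (d : V -> R) (U : {set V}) :
  (forall i, 0 < d i) -> rigid W U -> rigid (rescale d W) U.
Proof.
move=> d_gt0 rig x z ux bal; apply: (rig (fun j => (d j)%:C * x j)) => [i iU|i iU].
  by rewrite upperM ?ux.
have di : (d i)%:C != 0 by rewrite fmorph_eq0 gt_eqF.
apply: (mulfI di); rewrite mulr0 -[RHS](bal i iU) mulr_sumr; apply: eq_bigr => j _.
by rewrite /rescale !rmorphM /=; ring.
Qed.

Section CompleteGraph4.

(* The spanning tree polynomial of the complete graph on {1, 2, 3, 4} with weights w_12 = a,
   w_13 = b, w_23 = c and w_i4 = 1. *)
Definition k4_poly (K : comNzRingType) (a b c x1 x2 x3 x4 : K) : K :=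
  a * b * x1 ^+ 2 + a * c * x2 ^+ 2 + b * c * x3 ^+ 2 + x4 ^+ 2
  + a * (b + c) * x1 * x2 + b * (a + c) * x1 * x3 + c * (a + b) * x2 * x3
  + (a + b) * x1 * x4 + (a + c) * x2 * x4 + (b + c) * x3 * x4.

Definition k4_polar1 (K : comNzRingType) (a b c x1 x2 x3 x4 : K) : K :=
  (4 * a * b + a * c + b * c + a + b) * x1 + (4 * a * c + a * b + b * c + a + c) * x2
  + (4 * b * c + a * b + a * c + b + c) * x3 + 2 * (1 + a + b + c) * x4.

Lemma k4_poly_shift (K : comNzRingType) (a b c x1 x2 x3 x4 s : K) :
  k4_poly a b c (x1 + s) (x2 + s) (x3 + s) (x4 + s) =
  k4_poly a b c x1 x2 x3 x4 + s * k4_polar1 a b c x1 x2 x3 x4 + s ^+ 2 * k4_poly a b c 1 1 1 1.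
Proof. by rewrite /k4_poly /k4_polar1; ring. Qed.

Lemma k4_poly_map (K K' : comNzRingType) (phi : {rmorphism K -> K'}) (a b c x1 x2 x3 x4 : K) :
  phi (k4_poly a b c x1 x2 x3 x4) =
  k4_poly (phi a) (phi b) (phi c) (phi x1) (phi x2) (phi x3) (phi x4).
Proof. by rewrite /k4_poly !(rmorphD, rmorphM, rmorphXn). Qed.

(* For distinct a, b, c the quadratic form has signature (2, 2). *)
Lemma k4_positive_orthogonal (K : realFieldType) (a b c : K) :
  0 < a -> 0 < b -> 0 < c -> a != b -> b != c -> c != a ->
  exists v1 v2 v3 v4 : K, k4_polar1 a b c v1 v2 v3 v4 = 0 /\ 0 < k4_poly a b c v1 v2 v3 v4.
Proof.
move=> a0 b0 c0 nab nbc nca.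
have [ab bc ca] : [/\ a - b != 0, b - c != 0 & c - a != 0] by rewrite !subr_eq0.
pose v1 := (a - b)^-1; pose v2 := (c - a)^-1; pose v3 := (b - c)^-1.
have g4 : 2 * (1 + a + b + c) != 0 by rewrite gt_eqF //; lra.
pose v4 := - k4_polar1 a b c v1 v2 v3 0 / (2 * (1 + a + b + c)).
exists v1, v2, v3, v4; split.
  by rewrite /v4 /k4_polar1 mulr0 addr0 [X in _ + X]mulrC divfK // addrN.
suff -> : k4_poly a b c v1 v2 v3 v4 =
    (v4 + ((a + b) * v1 + (a + c) * v2 + (b + c) * v3) / 2) ^+ 2 + 3 / 4.
  by apply: ltr_wpDl; [exact: sqr_ge0 | lra].
by move: v4 => v4; rewrite /k4_poly /v1 /v2 /v3; field; rewrite ab bc ca.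
Qed.

Lemma k4_poly_upper_zero (R : rcfType) (a b c : R) :
  0 < a -> 0 < b -> 0 < c -> a != b -> b != c -> c != a ->
  exists x1 x2 x3 x4 : R[i], [/\ upper x1, upper x2, upper x3, upper x4 &
    k4_poly a%:C b%:C c%:C x1 x2 x3 x4 = 0].
Proof.
move=> a0 b0 c0 ab bc ca.
have [v1 [v2 [v3 [v4 [polar0 qv]]]]] := k4_positive_orthogonal a0 b0 c0 ab bc ca.
have q1 : 0 < k4_poly a b c 1 1 1 1.
  by rewrite /k4_poly !expr1n !mulr1; do !apply: addr_gt0; rewrite ?mulr_gt0 ?addr_gt0.
pose t := Num.sqrt (k4_poly a b c v1 v2 v3 v4 / k4_poly a b c 1 1 1 1).
have t_gt0 : 0 < t by rewrite sqrtr_gt0 divr_gt0.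
have up (v : R) : upper (v%:C + 'i * t%:C).
  by rewrite /upper /= mul0r mul1r !add0r.
exists (v1%:C + 'i * t%:C), (v2%:C + 'i * t%:C), (v3%:C + 'i * t%:C), (v4%:C + 'i * t%:C).
split=> //; rewrite k4_poly_shift exprMn sqr_i -(rmorph1 (real_complex R)) -k4_poly_map.
have -> : k4_polar1 a%:C b%:C c%:C v1%:C v2%:C v3%:C v4%:C = (k4_polar1 a b c v1 v2 v3 v4)%:C.
  by rewrite /k4_polar1 !(rmorphD, rmorphM, rmorph_nat, rmorph1).
rewrite polar0 -k4_poly_map -(rmorphXn (real_complex R)) sqr_sqrtr ?divr_ge0 ?ltW //.
by rewrite mulr0 addr0 -mulrA -rmorphM divfK ?gt_eqF // mulN1r subrr.
Qed.

(* z1, z2, z3 are cofactors of a row of the Laplacian rooted at 4. *)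
Lemma k4_kernel (K : comNzRingType) (a b c x1 x2 x3 x4 : K) :
  k4_poly a b c x1 x2 x3 x4 = 0 -> exists z1 z2 z3 : K,
  [/\ a * x2 * (z2 - z1) + b * x3 * (z3 - z1) + x4 * (0 - z1) = 0,
      a * x1 * (z1 - z2) + c * x3 * (z3 - z2) + x4 * (0 - z2) = 0,
      b * x1 * (z1 - z3) + c * x2 * (z2 - z3) + x4 * (0 - z3) = 0,
      x1 * (z1 - 0) + x2 * (z2 - 0) + x3 * (z3 - 0) = 0 &
      z1 = x3 * (a * b * x1 + a * c * x2 + b * c * x3 + b * x4)].
Proof.
move=> q0; exists (x3 * (a * b * x1 + a * c * x2 + b * c * x3 + b * x4)).
exists (b * x3 * (a * x1) + (a * x2 + b * x3 + x4) * (c * x3)).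
exists ((a * x2 + b * x3 + x4) * (a * x1 + c * x3 + x4) - a ^+ 2 * x1 * x2).
split=> //; first by ring.
- by ring.
- transitivity (- x4 * k4_poly a b c x1 x2 x3 x4); last by rewrite q0 mulr0.
  by rewrite /k4_poly; ring.
- transitivity (x3 * k4_poly a b c x1 x2 x3 x4); last by rewrite q0 mulr0.
  by rewrite /k4_poly; ring.
Qed.

End CompleteGraph4.

Section FourPoint.
Variables (R : rcfType) (V : finType).
Implicit Types (W N : V -> V -> R) (i j k l : V).

Lemma sum_set4 (F : V -> R[i]) i j k l : uniq [:: i; j; k; l] ->
  \sum_(m in [set i; j; k; l]) F m = F i + F j + F k + F l.
Proof.
move=> un; transitivity (\sum_(m <- [:: i; j; k; l]) F m).
  rewrite big_uniq //; apply: eq_bigl => m.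
  by rewrite !inE !orbA.
by rewrite !big_cons big_nil addr0 !addrA.
Qed.

Lemma rigid_k4_isosceles W i j k l :
  (forall i j, W i j = W j i) -> (forall i j, 0 < W i j) -> uniq [:: i; j; k; l] ->
  W i l = 1 -> W j l = 1 -> W k l = 1 -> rigid W [set i; j; k; l] ->
  [|| W i j == W i k, W i k == W j k | W j k == W i j].
Proof.
move=> WC W_gt0 un Wil Wjl Wkl rig; apply: contraT; rewrite !negb_or => /and3P [ab bc ca].
have [x1 [x2 [x3 [x4 [u1 u2 u3 u4]]]]] :=
  k4_poly_upper_zero (W_gt0 i j) (W_gt0 i k) (W_gt0 j k) ab bc ca.
move=> /k4_kernel [z1 [z2 [z3 [eq1 eq2 eq3 eq4 z1E]]]].
pose at4 (y1 y2 y3 y4 : R[i]) m :=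
  if m == i then y1 else if m == j then y2 else if m == k then y3 else y4.
have at4E y1 y2 y3 y4 : [/\ at4 y1 y2 y3 y4 i = y1, at4 y1 y2 y3 y4 j = y2,
    at4 y1 y2 y3 y4 k = y3 & at4 y1 y2 y3 y4 l = y4].
  move: un; rewrite /at4 /= !inE !negb_or => /and4P [/and3P [ij ik il] /andP [jk jl] kl _].
  rewrite !eqxx (eq_sym j i) !(eq_sym k) !(eq_sym l).
  by rewrite (negPf ij) (negPf ik) (negPf il) (negPf jk) (negPf jl) (negPf kl).
pose x := at4 x1 x2 x3 x4; pose z := at4 z1 z2 z3 0.
have [xi xj xk xl] : [/\ x i = x1, x j = x2, x k = x3 & x l = x4] by exact: at4E.
have [zi zj zk zl] : [/\ z i = z1, z j = z2, z k = z3 & z l = 0] by exact: at4E.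
have : z i = z l.
  apply: (rig x); [move=> m|move=> m mU|by rewrite !inE eqxx|by rewrite !inE eqxx !orbT].
    by rewrite !inE -!orbA => /or4P [] /eqP ->; rewrite ?xi ?xj ?xk ?xl.
  rewrite (sum_set4 _ un) xi xj xk xl zi zj zk zl.
  move: mU; rewrite !inE -!orbA => /or4P [] /eqP ->.
  - by rewrite zi Wil subrr mulr0 add0r mul1r.
  - by rewrite zj Wjl (WC j i) subrr mulr0 addr0 mul1r.
  - by rewrite zk Wkl (WC k i) (WC k j) subrr mulr0 addr0 mul1r.
  - by rewrite zl !(WC l) Wil Wjl Wkl subrr mulr0 addr0 !mul1r.
rewrite zi zl z1E => /eqP; apply: contraLR => _; rewrite mulf_neq0 ?upper_neq0 //.
rewrite /upper !ImD -!rmorphM !ImMr.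
by do !apply: addr_gt0; rewrite !mulr_gt0.
Qed.

Lemma rigid_four_point N i j k l :
  (forall i j, N i j = N j i) -> (forall i j, 0 < N i j) ->
  rigid N [set i; j; k; l] -> four_point N i j k l.
Proof.
move=> NC N_gt0 rig; have [un|] := boolP (uniq [:: i; j; k; l]); last exact: four_point_not_uniq.
have d_gt0 m : 0 < pivot l N m by exact: pivot_gt0.
rewrite -(four_point_rescale _ _ _ _ (d := pivot l N)) => [|m]; last by rewrite gt_eqF.
have W1 m : m != l -> rescale (pivot l N) N m l = 1 by move=> ml; apply: normalized1; rewrite ?gt_eqF.
have [il jl kl] : [/\ i != l, j != l & k != l].
  by move: un; rewrite /= !inE !negb_or => /and4P [/and3P [_ _ ->] /andP [_ ->] -> _].
rewrite /four_point !(W1 i, W1 j, W1 k) // !mulr1 !mul1r.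
apply: (rigid_k4_isosceles (l := l)); rewrite ?W1 //.
- by move=> m m'; exact: rescaleC.
- by move=> m m'; rewrite !mulr_gt0.
- exact: rigid_rescale.
Qed.

End FourPoint.

(** * Twins from the four-point condition *)

Section EdgeColourings.
Variables (V : finType) (C : eqType) (d : V -> V -> C).
Hypothesis dC : forall i j, d i j = d j i.
Implicit Types (U M : {set V}) (i j k l s p q x y : V).

(* The vertices below need not be distinct: the degenerate instances hold by symmetry of d. *)
Definition no_rainbow U : Prop := {in U & U & U, forall i j k,
  [|| d j k == d i k, d i k == d i j | d i j == d j k]}.

Definition no_bicoloured_path U : Prop := forall i j k l,
  i \in U -> j \in U -> k \in U -> l \in U ->
  d i j = d j k -> d j k = d k l -> d i k = d i l -> d i l = d j l -> d i j = d i k.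

Definition equidistant U p q : Prop :=
  [/\ p \in U, q \in U, p != q & forall k, k \in U :\: [set p; q] -> d p k = d q k].

Lemma equidistantC U p q : equidistant U p q -> equidistant U q p.
Proof. by case=> pU qU pq eq_pq; split; rewrite // 1?eq_sym // => k; rewrite setUC => /eq_pq. Qed.

Lemma module_equidistant U M p q : M \subset U ->
  (forall x y k, x \in M -> y \in M -> k \in U :\: M -> d x k = d y k) ->
  equidistant M p q -> equidistant U p q.
Proof.
move=> /subsetP MU moduleM [pM qM pq eq_pq]; split; rewrite ?MU // => k.
rewrite !inE => /andP [kpq kU]; have [kM|kM] := boolP (k \in M).
  by apply: eq_pq; rewrite !inE kpq.
by apply: moduleM; rewrite ?inE ?kM.
Qed.

Section Extension.
Variables (U : {set V}) (s p q : V).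
Hypotheses (rainbowU : no_rainbow U) (pathU : no_bicoloured_path U) (sU : s \in U).
Hypotheses (eq_pq : equidistant (U :\ s) p q) (dsp_neq : d s p != d s q) (dpq : d p q = d s q).

Definition split_module : {set V} := [set x in U :\ q | [|| x == s, x == p | d s x != d p x]].

Let pU : p \in U. Proof. by case: eq_pq => /setD1P []. Qed.
Let qU : q \in U. Proof. by case: eq_pq => _ /setD1P []. Qed.

Let dq x : x \in U -> x != s -> x != p -> x != q -> d q x = d p x.
Proof.
case: eq_pq => _ _ _ dpqE xU xs xp xq; rewrite -dpqE // !inE negb_or.
by rewrite xs xp xq.
Qed.

Lemma split_distances x : x \in U -> x != s -> x != p -> x != q -> d s x != d p x ->
  d s x = d s p /\ d p x = d s q.
Proof.
move=> xU xs xp xq sx_px; have qx := dq xU xs xp xq.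
have := rainbowU sU pU xU; have := rainbowU sU qU xU.
rewrite qx [d p x == _]eq_sym (negPf sx_px) /= => /orP [] /eqP eq_q /orP [] /eqP eq_p //.
- by case/eqP: dsp_neq; rewrite -eq_p.
- case/eqP: dsp_neq; rewrite -dpq [LHS]dC; apply/esym/(pathU pU qU sU xU).
  + by rewrite dpq dC.
  + by rewrite dC.
  + by rewrite dC.
  + by [].
- by case/eqP: dsp_neq; rewrite eq_p.
Qed.

Lemma split_module_distance x k : x \in split_module -> k \in U :\: split_module -> d x k = d p k.
Proof.
rewrite !inE => /andP [/andP [xq xU] xM] /andP [kM kU].
have [->//|xp] := eqVneq x p.
have [kq|kq] := eqVneq k q.
  have [->|xs] := eqVneq x s; first by rewrite kq dpq.
  rewrite (negPf xs) (negPf xp) /= in xM.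
  have [_ px] := split_distances xU xs xp xq xM.
  by rewrite kq dpq dC dq.
move: kM; rewrite kq kU /= !negb_or negbK => /and3P [ks kp /eqP sk].
have [->//|xs] := eqVneq x s; rewrite (negPf xs) (negPf xp) /= in xM.
have [sx px] := split_distances xU xs xp xq xM; have qk := dq kU ks kp kq.
apply: contraTeq dsp_neq => xk_pk; rewrite negbK; apply/eqP.
have := rainbowU sU xU kU; have := rainbowU pU xU kU.
rewrite sk (negPf xk_pk) /= => /orP [] /eqP eq_p /orP [] /eqP eq_s.
- by rewrite -px -sx -eq_s -eq_p.
- rewrite dC -px; apply: (pathU pU sU xU kU) => //.
  by rewrite dC sx.
- rewrite -sx -eq_s -qk [RHS]dC; apply: (pathU qU kU sU xU).
  + by rewrite qk [RHS]dC sk.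
  + by rewrite dC sk.
  + by rewrite dC -px dq.
  + by rewrite dq // eq_p dC.
- by rewrite -sx eq_s -eq_p.
Qed.

Lemma split_module_proper : split_module \proper U.
Proof.
apply/properP; split; first by apply/subsetP => x; rewrite !inE => /andP [/andP []].
by exists q; rewrite // !inE eqxx.
Qed.

Lemma split_module_gt1 : (1 < #|split_module|)%N.
Proof.
have [/setD1P [ps _] /setD1P [qs _] pq _] := eq_pq.
by apply/card_gt1P; exists s, p; rewrite !inE !eqxx sU pU pq orbT !(eq_sym s) qs ps.
Qed.

End Extension.

Lemma exists_equidistant U : no_rainbow U -> no_bicoloured_path U -> (1 < #|U|)%N ->
  exists p q, equidistant U p q.
Proof.
have [n] := ubnP #|U|; elim: n U => // n IH U Un rainbowU pathU U2.
have IHsub M : M \proper U -> (1 < #|M|)%N -> exists p q, equidistant M p q.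
  move=> /[dup] /proper_card MU /proper_sub/subsetP sub; apply: IH.
  - exact: leq_trans MU Un.
  - by move=> i j k iM jM kM; apply: rainbowU; apply: sub.
  - by move=> i j k l iM jM kM lM; apply: pathU; apply: sub.
have [U3|U_le2] := ltnP 2 #|U|; last first.
  have /cards2P [p [q [pq ->]]] : #|U| == 2%N by rewrite eqn_leq U_le2.
  by exists p, q; split; rewrite ?set21 ?set22 // => k; rewrite setDv inE.
have /card_gt0P [s sU] : (0 < #|U|)%N by lia.
have cardUs := cardsD1 s U; rewrite sU in cardUs.
have [||p [q eq_pq]] := IHsub (U :\ s); [exact: properD1|lia|].
have [dsp|dsp] := eqVneq (d s p) (d s q).
  have [/setD1P [_ pU] /setD1P [_ qU] pq dpqE] := eq_pq.
  exists p, q; split=> // k; rewrite !inE negb_or => /andP [/andP [kp kq] kU].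
  by have [->|ks] := eqVneq k s; [rewrite !(dC _ s)|rewrite dpqE // !inE negb_or kp kq ks].
wlog dpq : p q eq_pq dsp / d p q = d s q => [wlog_dpq|].
  have [/setD1P [_ pU] /setD1P [_ qU] _ _] := eq_pq.
  have /or3P [/eqP dpq|/eqP dsq|/eqP dqs] := rainbowU s p q sU pU qU.
  - exact: (wlog_dpq p q).
  - by rewrite dsq eqxx in dsp.
  - by apply: (wlog_dpq q p); [exact: equidistantC|rewrite eq_sym|rewrite dC].
have Mproper := split_module_proper eq_pq.
have [i [j eq_ij]] := IHsub _ Mproper (split_module_gt1 sU eq_pq).
exists i, j; apply: module_equidistant (proper_sub Mproper) _ eq_ij => x y k xM yM kU.
by rewrite !(split_module_distance rainbowU pathU sU eq_pq dsp dpq).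
Qed.

End EdgeColourings.

Section FourPointTwins.
Variables (K : realFieldType) (V : finType) (N : V -> V -> K).
Hypotheses (NC : forall i j, N i j = N j i) (N_gt0 : forall i j, 0 < N i j).
Hypothesis fourN : forall i j k l, four_point N i j k l.
Implicit Types (U : {set V}) (q : V).

Let pivot_neq0 q i : pivot q N i != 0. Proof. by rewrite gt_eqF ?pivot_gt0. Qed.

Let normalizedC q i j : normalized q N i j = normalized q N j i. Proof. exact: rescaleC. Qed.

Let normalized1N q i : i != q -> normalized q N i q = 1.
Proof. by apply: normalized1; rewrite gt_eqF. Qed.

Lemma no_rainbow_normalized q U : no_rainbow (normalized q N) (U :\ q).
Proof.
move=> i j k /setD1P [iq _] /setD1P [jq _] /setD1P [kq _].
have : four_point (normalized q N) q i j k by rewrite four_point_rescale.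
by rewrite /four_point !(normalizedC q q) !normalized1N // !mul1r.
Qed.

(* A two-coloured path makes the three products s^2, t^2 and s t, for its colours s and t. *)
Lemma no_bicoloured_path_normalized q U : no_bicoloured_path (normalized q N) U.
Proof.
have d_gt0 i j : 0 < normalized q N i j by rewrite !mulr_gt0 ?pivot_gt0.
move=> i j k l _ _ _ _ ij_jk jk_kl ik_il il_jl.
have : four_point (normalized q N) i j k l by rewrite four_point_rescale.
rewrite /four_point -jk_kl -il_jl -ik_il ij_jk => /or3P [].
- by rewrite -!expr2 eqrXn2 ?ltW // => /eqP.
- by move/eqP/(mulfI (lt0r_neq0 (d_gt0 i k))).
- by move/eqP/(mulIf (lt0r_neq0 (d_gt0 j k))).
Qed.

Lemma equidistant_normalized_twins q U u v :
  equidistant (normalized q N) (U :\ q) u v -> twins N U u v.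
Proof.
move=> [/setD1P [uq uU] /setD1P [vq vU] uv eq_uv]; split=> //.
apply: (rank_le1_rescale (pivot_neq0 q)); rewrite -/(normalized q N).
have row k i : k \in U :\: [set u; v] -> i \in [set u; v] -> normalized q N i k = normalized q N v k.
  rewrite !inE negb_or => /andP [/andP [ku kv] kU] /orP [] /eqP -> //.
  have [->|kq] := eqVneq k q; first by rewrite !normalized1N.
  by rewrite eq_uv // !inE negb_or ku kv kq.
by move=> i i' k k' iuv i'uv kU k'U; rewrite !(row k) // !(row k') // mulrC.
Qed.

Lemma four_point_hereditary_twins U : hereditary_twins N U.
Proof.
move=> A _ A2; have [A4|A3] := ltnP 3 #|A|; last by apply: small_set_twins; rewrite ?A2.
have /card_gt0P [q qA] : (0 < #|A|)%N by exact: ltnW.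
have Aq2 : (1 < #|A :\ q|)%N by have := cardsD1 q A; rewrite qA; lia.
have [u [v eq_uv]] := exists_equidistant (normalizedC q) (no_rainbow_normalized (U := A))
  (@no_bicoloured_path_normalized q _) Aq2.
by exists u, v; exact: equidistant_normalized_twins eq_uv.
Qed.

End FourPointTwins.

(** * Building a decomposition from twins *)

Section Cherry.
Variables (T : finType) (r : T) (f : T -> T) (l : T).
Hypothesis rf : rooted r f.

Definition cherry (y : T + bool) : T + bool :=
  if y is inl x then inl (f x) else inl l.

Lemma cherry_rooted : rooted (inl r) cherry.
Proof.
have /rootedP [fr [h hf]] := rf; apply/rootedP; split; first by rewrite /= fr.
by exists (fun y => if y is inl x then h x else (h l).+1) => -[x|b] //; exact: hf.
Qed.

Lemma iter_cherry n x : iter n cherry (inl x) = inl (iter n f x).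
Proof. by elim: n => //= n ->. Qed.

Lemma fconnect_cherry x y : fconnect cherry (inl x) (inl y) = fconnect f x y.
Proof.
apply/idP/idP => /iter_findex; first by rewrite iter_cherry => -[<-]; exact: fconnect_iter.
by move=> <-; rewrite -iter_cherry; exact: fconnect_iter.
Qed.

Lemma fconnect_cherry_new x b : fconnect cherry (inl x) (inr b) = false.
Proof. by apply/negP => /iter_findex; rewrite iter_cherry. Qed.

Lemma parent_deg_cherry x :
  parent_deg (inl r) cherry (inl x) = (parent_deg r f x + 2 * (x == l))%N.
Proof.
rewrite /parent_deg addnAC; congr (_ + _)%N; rewrite -!sum1_card.
under eq_bigl do rewrite inE.
rewrite big_sumType /=; congr (_ + _)%N; first by apply: eq_bigl => y; rewrite inE.
by rewrite big_mkcond big_bool /= -[inl l == inl x]/(l == x) eq_sym; case: eqP.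
Qed.

Lemma parent_deg_cherry_new b : parent_deg (inl r) cherry (inr b) = 1%N.
Proof.
rewrite /parent_deg (_ : children _ _ _ = set0) ?cards0 //.
by apply/setP => -[x|b']; rewrite !inE andbF.
Qed.

End Cherry.

Section Growth.
Variables (K : numFieldType) (V : finType) (W : V -> V -> K).
Hypotheses (WC : forall i j, W i j = W j i) (W_ge0 : forall i j, 0 <= W i j).
Implicit Types (U A S : {set V}) (i j k v : V).

Lemma rank_le1_decomposition_pair i j : i != j -> rank_le1_decomposition W [set i; j].
Proof.
move=> ij; pose leaf v := v == i; have ji : (j == i) = false by rewrite eq_sym (negPf ij).
have leafi : leaf i = true by rewrite /leaf eqxx.
have leafj : leaf j = false by rewrite /leaf ji.
have rooted_true : rooted true xpredT by apply/rootedP; split=> //; exists negb => -[].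
exists bool, true, xpredT, leaf; split; first split=> //.
- by move=> u v /set2P [] -> /set2P [] ->; rewrite ?leafi ?leafj.
- move=> b; have -> : b \in leaf @: [set i; j].
    by case: b; apply/imsetP; [exists i|exists j]; rewrite ?set21 ?set22.
  rewrite /parent_deg; case: b.
    by rewrite addn0 -(cards1 false); apply: eq_card => -[]; rewrite !inE.
  by rewrite (_ : children _ _ _ = set0) ?cards0 //; apply/setP => -[]; rewrite !inE.
case=> // _; apply: rank_le1_card; rewrite -(cards1 j); apply/subset_leq_card/subsetP => v.
by rewrite !inE => /andP [/orP [] /eqP -> //]; rewrite leafi fconnect_root.
Qed.

Section Split.
Variables (U : {set V}) (i j : V) (c : K).
Hypothesis prop_ij : proportional W U i j c.

Definition merge v : V := if v == i then j else v.

Lemma rank_le1_merge S : S \subset U :\ i -> rank_le1 W S ((U :\ i) :\: S) ->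
  rank_le1 W [set v in U | merge v \in S] (U :\: [set v in U | merge v \in S]).
Proof.
case: prop_ij => iU jU ij _ prop /subsetP SU.
have notin k : k \in U :\: [set v in U | merge v \in S] -> merge k \notin S /\ k \in U.
  by rewrite !inE => /andP [+ kU]; rewrite kU.
pose g v := if v == i then c else 1.
apply: (rank_le1_pullback (phi := merge) (g := g) (h := g)) => [a|k /notin [kS kU]|a k].
- by rewrite inE => /andP [].
- rewrite !inE kS /merge /=.
  by have [_|ki] := eqVneq k i; [rewrite eq_sym ij|rewrite ki].
rewrite inE => /andP [aU + /notin [+ kU]]; rewrite /merge /g.
case: eqVneq => [->|ai]; case: eqVneq => [->|ki] aS kS.
- by rewrite aS in kS.
- rewrite mulr1 prop // !inE negb_or ki kU andbT /=.
  by apply: contraNneq kS => ->.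
- rewrite mul1r !(WC a) prop // !inE negb_or ai aU andbT /=.
  by apply: contraNneq kS => <-.
- by rewrite !mul1r.
Qed.

Variables (T : finType) (r : T) (f : T -> T) (leaf : V -> T).
Hypothesis cub : cubic_on (U :\ i) r f leaf.

Definition cherry_leaf v : T + bool :=
  if v == i then inr true else if v == j then inr false else inl (leaf v).

Let cherry_leafi : cherry_leaf i = inr true. Proof. by rewrite /cherry_leaf eqxx. Qed.

Let cherry_leafj : cherry_leaf j = inr false.
Proof. by case: prop_ij => _ _ ij _ _; rewrite /cherry_leaf eq_sym (negPf ij) eqxx. Qed.

Lemma fconnect_cherry_leaf v y :
  fconnect (cherry f (leaf j)) (cherry_leaf v) (inl y) = fconnect f (leaf (merge v)) y.
Proof.
rewrite /cherry_leaf /merge; case: eqVneq => _.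
  by rewrite [LHS]fconnect_eqVf /= fconnect_cherry.
case: eqVneq => [->|_]; last by rewrite fconnect_cherry.
by rewrite [LHS]fconnect_eqVf /= fconnect_cherry.
Qed.

Lemma fconnect_cherry_leaf_new v b :
  fconnect (cherry f (leaf j)) (cherry_leaf v) (inr b) = (cherry_leaf v == inr b).
Proof.
by rewrite fconnect_eqVf; case: (cherry_leaf v) => [x|b'] /=; rewrite fconnect_cherry_new ?orbF.
Qed.

Lemma cherry_leaf_inj : {in U &, injective cherry_leaf}.
Proof.
have [_ linj _] := cub; move=> u v uU vU; rewrite /cherry_leaf.
case: (eqVneq u i) => [->|ui]; case: (eqVneq v i) => [->|vi] //; try by case: ifP.
case: (eqVneq u j) => [->|uj]; case: (eqVneq v j) => [->|vj] // [].
by apply: linj; rewrite !inE ?ui ?vi.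
Qed.

Lemma mem_cherry_leaf x :
  (inl x \in cherry_leaf @: U) = (x \in leaf @: (U :\ i)) && (x != leaf j).
Proof.
case: prop_ij => iU jU ij _ _; have [_ linj _] := cub.
have jU' : j \in U :\ i by rewrite !inE eq_sym ij.
apply/imsetP/andP => [[v vU]|[/imsetP [v vU ->] vj]].
  rewrite /cherry_leaf; case: eqVneq => // vi; case: eqVneq => // vj [->].
  have vU' : v \in U :\ i by rewrite !inE vi.
  by rewrite imset_f // (inj_in_eq linj).
exists v; first by case/setD1P: vU.
rewrite /cherry_leaf; case/setD1P: vU => /negPf -> _.
by case: (eqVneq v j) vj => // ->; rewrite eqxx.
Qed.

Lemma cubic_cherry : cubic_on U (inl r) (cherry f (leaf j)) cherry_leaf.
Proof.
have [rf _ pdeg] := cub; have [iU jU ij _ _] := prop_ij.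
split; [exact: cherry_rooted|exact: cherry_leaf_inj|case=> [x|b]].
  rewrite parent_deg_cherry pdeg mem_cherry_leaf.
  case: eqVneq => [->|_]; last by rewrite addn0 andbT.
  by rewrite imset_f ?andbF // !inE eq_sym ij.
by rewrite parent_deg_cherry_new; case: b; rewrite -?cherry_leafi -?cherry_leafj imset_f.
Qed.

Lemma below_cherry y : below (cherry f (leaf j)) cherry_leaf U (inl y) =
  [set v in U | merge v \in below f leaf (U :\ i) y].
Proof.
case: prop_ij => iU jU ij _ _; apply/setP => v; rewrite !inE fconnect_cherry_leaf.
have [vU|//] := boolP (v \in U); rewrite /= /merge; case: eqVneq => [_|vi].
  by rewrite eq_sym ij jU.
by rewrite vi vU.
Qed.

Lemma card_below_cherry_new b : (#|below (cherry f (leaf j)) cherry_leaf U (inr b)| <= 1)%N.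
Proof.
apply/card_le1_eqP => u v; rewrite !inE !fconnect_cherry_leaf_new.
by move=> /andP [uU /eqP uE] /andP [vU /eqP vE]; apply: cherry_leaf_inj; rewrite // uE.
Qed.

End Split.

Lemma rank_le1_decomposition_proportional U i j c :
  proportional W U i j c -> rank_le1_decomposition W (U :\ i) -> rank_le1_decomposition W U.
Proof.
move=> prop [T [r [f [leaf [cub cuts]]]]].
exists (T + bool)%type, (inl r), (cherry f (leaf j)), (cherry_leaf i j leaf).
split=> [|[y yr|b _]]; first exact: (cubic_cherry prop cub).
  rewrite (below_cherry prop); apply: (rank_le1_merge prop).
    by apply/subsetP => v; rewrite inE => /andP [].
  by apply: cuts; apply: contra_neq yr => ->.
by apply: rank_le1_card; exact: (card_below_cherry_new j cub b).
Qed.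

Lemma hereditary_twins_decomposition U :
  hereditary_twins W U -> (1 < #|U|)%N -> rank_le1_decomposition W U.
Proof.
have [n] := ubnP #|U|; elim: n U => // n IH U Un twinsU U2.
have [U3|U_le2] := ltnP 2 #|U|; last first.
  have /cards2P [i [j [ij ->]]] : #|U| == 2%N by rewrite eqn_leq U_le2.
  exact: rank_le1_decomposition_pair.
have [u [v /(twins_proportional W_ge0) [i [j [c prop]]]]] := twinsU U (subxx U) U2.
apply: (rank_le1_decomposition_proportional prop).
have [iU _ _ _ _] := prop; have cardU := cardsD1 i U; rewrite iU in cardU.
by apply: IH => [|A /subset_trans AU|]; [lia|apply/twinsU/AU/subsetDl|lia].
Qed.

End Growth.

(** * Stability and width *)

Section StabilityAndWidth.
Variables (R : realType) (V : finType) (E : {set {set V}}) (w : {set V} -> R).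
Hypotheses (cE : connected_graph E) (w_gt0 : forall e, e \in E -> 0 < w e).

Let connW : weight_connected (wadj E w) setT.
Proof. exact: connected_weight_connected. Qed.

Lemma cut_rank_gt0 (A : {set V}) : A != set0 -> A != setT -> (0 < cut_rank E w A)%N.
Proof.
move=> /set0Pn [u uA] AT; have [v vA] : exists v, v \in ~: A.
  by apply/set0Pn; apply: contra_neq AT => A0; rewrite -[A]setCK A0 setC0.
have uv : (u \in A) != (v \in A) by move: vA; rewrite inE uA => /negPf ->.
rewrite lt0n mxrank_eq0; apply: contraNneq uv => /matrixP cut0; apply/eqP.
apply: (connW (g := fun i => i \in A)) => // i j _ _.
have zero k l : k \in ~: A -> l \in A -> wadj E w k l = 0.
  move=> kA lA; have := cut0 (enum_rank_in kA k) (enum_rank_in lA l).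
  by rewrite !mxE /= !enum_rankK !enum_rankK_in.
apply: contraNeq => ij; apply/eqP.
case: (boolP (i \in A)) ij => iA; case: (boolP (j \in A)) => // jA _.
  by rewrite wadjC zero // inE.
by rewrite zero // inE.
Qed.

Lemma tree_width_gt0 (T : leaf_tree V) : (1 < #|V|)%N -> (0 < tree_width E w T)%N.
Proof.
rewrite -cardsT => /card_gt1P [u [v [_ _ uv]]].
have [f rf TE] := tree_parent_edges (leaf T v) (tree_edgesP T).
have u_not_root : leaf T u != leaf T v by rewrite (inj_eq (@leaf_inj _ T)).
set e := [set leaf T u; f (leaf T u)].
have eT : e \in tree_edges T by rewrite TE; apply/parent_edgesP; exists (leaf T u).
have sideP i : i \in side e (leaf T u) = fconnect f (leaf T i) (leaf T u).
  by rewrite inE TE connect_cut_child.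
apply: leq_trans (leq_bigmax_cond (F := fun e => edge_width E w e) e eT).
apply: leq_trans (leq_bigmax_cond (F := fun a => cut_rank E w (side e a)) _ (set21 _ _)).
apply: cut_rank_gt0; first by apply/set0Pn; exists u; rewrite sideP connect0.
apply: contraTneq (in_setT v) => <-.
by rewrite sideP fconnect_root.
Qed.

Lemma rank_le1_decomposition_rigid :
  rank_le1_decomposition (wadj E w) setT -> rigid (wadj E w) setT.
Proof.
move=> decomp; apply: hereditary_twins_rigid => //; [exact: wadjC|by move=> i j; exact: wadj_ge0|].
by apply: rank_le1_decomposition_hereditary_twins decomp; exact: wadjC.
Qed.

Lemma rigid_rank_le1_decomposition :
  (1 < #|V|)%N -> rigid (wadj E w) setT -> rank_le1_decomposition (wadj E w) setT.
Proof.
move=> V2 rig; pose N := resolvent (wadj E w).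
have WC : forall i j, wadj E w i j = wadj E w j i by exact: wadjC.
have W_ge0 i j : 0 <= wadj E w i j by exact: wadj_ge0.
have NC : forall i j, N i j = N j i by exact: resolventC.
have N_gt0 i j : 0 < N i j by exact: resolvent_gt0.
have four i j k l : four_point N i j k l.
  by apply/rigid_four_point/rigid_subset/rigid_resolvent.
have [T [r [f [leaf [cub cuts]]]]] : rank_le1_decomposition N setT.
  apply: hereditary_twins_decomposition => // [i j||]; last by rewrite cardsT.
    exact: ltW.
  exact: four_point_hereditary_twins.
exists T, r, f, leaf; split=> // y /cuts.
by rewrite setTD; exact: rank_le1_resolvent.
Qed.

End StabilityAndWidth.

Theorem theorem3 (R : realType) (V : finType) (E : {set {set V}})
    (w : {set V} -> R)
    (hV : (1 < #|V|)%N)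
    (hsimple : simple_graph E)
    (hconn : connected_graph E)
    (hw : forall e, e \in E -> 0 < w e) :
  weighted_stable E w <-> has_width E w 1%N.
Proof.
have width_gt0 T := tree_width_gt0 hconn hw T hV.
have widthP := width_le1P E w (ltnW hV).
rewrite (weighted_stable_rigid E w hV); split=> [rig|[[T wT] _]].
  split=> //; have [T wT] := iffRL widthP (rigid_rank_le1_decomposition hconn hw hV rig).
  by exists T; apply/eqP; rewrite eqn_leq wT width_gt0.
by apply: rank_le1_decomposition_rigid => //; apply/widthP; exists T; rewrite wT.
Qed.
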